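(* Let $\varphi:\mathbb{R}^n\to\overline{\mathbb{R}}$ be l.s.c. and subdifferentially continuous at $\bar x\in\operatorname{dom}\varphi$ for $\bar v\in\partial\varphi(\bar x)$, and let $\sigma>0$. Then the following assertions are equivalent: (i) $\varphi$ is variationally strongly convex at $\bar x$ for $\bar v$ with modulus $\sigma$. (ii) $\varphi$ is prox-regular at $\bar x$ for $\bar v$ and there exist neighborhoods $U$ of $\bar x$ and $V$ of $\bar v$ such that $$\langle z,w\rangle\ge\sigma\|w\|^2\quad\text{whenever } z\in\breve\partial^2\varphi(x,y)(w),\ (x,y)\in\operatorname{gph}\partial\varphi\cap(U\times V),\ w\in\mathbb{R}^n.$$ (iii) $\varphi$ is prox-regular at $\bar x$ for $\bar v$ and there exist neighborhoods $U$ of $\bar x$ and $V$ of $\bar v$ such that $$\langle z,w\rangle\ge\sigma\|w\|^2\quad\text{whenever } z\in\partial^2\varphi(x,y)(w),\ (x,y)\in\operatorname{gph}\partial\varphi\cap(U\times V),\ w\in\mathbb{R}^n.$$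
   Context: Conventions: $\overline{\mathbb{R}}:=(-\infty,\infty]$; every extended-real-valued function is assumed proper, i.e. $\operatorname{dom}\varphi:=\{x\mid\varphi(x)<\infty\}\neq\emptyset$. $\mathbb{B}_\epsilon(a)$ is the closed ball with center $a$ and radius $\epsilon$; l.s.c. means lower semicontinuous. Subdifferentials: for $\bar x\in\operatorname{dom}\varphi$, the regular subdifferential is $$\widehat\partial\varphi(\bar x)=\Big\{v\in\mathbb{R}^n\;\Big|\;\liminf_{x\to\bar x}\frac{\varphi(x)-\varphi(\bar x)-\langle v,x-\bar x\rangle}{\|x-\bar x\|}\ge 0\Big\},$$ and the limiting subdifferential $\partial\varphi(\bar x)$ is the set of all $v$ for which there are $x_k\to\bar x$ with $\varphi(x_k)\to\varphi(\bar x)$ and $v_k\in\widehat\partial\varphi(x_k)$ with $v_k\to v$. For a set $\Omega$ with indicator function $\delta_\Omega$ ($0$ on $\Omega$, $\infty$ off $\Omega$) the regular and limiting normal cones at $\bar x\in\Omega$ are $\widehat N_\Omega(\bar x):=\widehat\partial\delta_\Omega(\bar x)$ and $N_\Omega(\bar x):=\partial\delta_\Omega(\bar x)$. Second-order subdifferentials: for $(x,y)\in\operatorname{gph}\partial\varphi$ and $w\in\mathbb{R}^n$, the combined and the limiting second-order subdifferentials are $$\breve\partial^2\varphi(x,y)(w):=\{z\mid(z,-w)\in\widehat N_{\operatorname{gph}\partial\varphi}(x,y)\},\qquad \partial^2\varphi(x,y)(w):=\{z\mid(z,-w)\in N_{\operatorname{gph}\partial\varphi}(x,y)\}.$$ Variational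 strong convexity: an l.s.c. function $\varphi$ is variationally strongly convex at $\bar x$ for $\bar v\in\partial\varphi(\bar x)$ with modulus $\sigma>0$ if for some convex neighborhood $U\times V$ of $(\bar x,\bar v)$ there exist an l.s.c. function $\psi\le\varphi$ on $U$ that is strongly convex on $U$ with modulus $\sigma$ (i.e. $\psi-\frac\sigma2\|\cdot\|^2$ is convex on $U$) and a number $\epsilon>0$ such that $$(U_\epsilon\times V)\cap\operatorname{gph}\partial\varphi=(U\times V)\cap\operatorname{gph}\partial\psi\quad\text{and}\quad\varphi(x)=\psi(x)\ \text{at the common elements }(x,v),$$ where $U_\epsilon:=\{x\in U\mid\varphi(x)<\varphi(\bar x)+\epsilon\}$. Prox-regularity: an l.s.c. function $\varphi$ is prox-regular at $\bar x\in\operatorname{dom}\varphi$ for $\bar v\in\partial\varphi(\bar x)$ if there exist $\epsilon>0$ and $r\ge0$ such that $\varphi(x)\ge\varphi(u)+\langle v,x-u\rangle-\frac r2\|x-u\|^2$ for all $x\in\mathbb{B}_\epsilon(\bar x)$ and all $(u,v)\in\operatorname{gph}\partial\varphi\cap(\mathbb{B}_\epsilon(\bar x)\times\mathbb{B}_\epsilon(\bar v))$ with $\varphi(u)<\varphi(\bar x)+\epsilon$. Subdifferential continuity: $\varphi$ is subdifferentially continuous at $\bar x$ for $\bar v\in\partial\varphi(\bar x)$ if for every $\epsilon>0$ there is $\delta>0$ such that $|\varphi(x)-\varphi(\bar x)|<\epsilon$ whenever $(x,v)\in\operatorname{gph}\partial\varphi\cap(\mathbb{B}_\delta(\bar x)\times\mathbb{B}_\delta(\bar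 v))$. *)

(* Defs.v *)
From HB Require Import structures.
From mathcomp Require Import all_boot all_order all_algebra.
From mathcomp Require Import all_classical all_reals.
From mathcomp Require Import ereal topology normedtype sequences convex.
Import Order.TTheory GRing.Theory Num.Theory.
Import numFieldNormedType.Exports.

Set Implicit Arguments.
Unset Strict Implicit.
Unset Printing Implicit Defensive.

Local Open Scope classical_set_scope.
Local Open Scope ring_scope.

(* The library's norm on 'rV[R]_n is the sup norm.  Its topology is the usual
   one, so nbhs and convergence are the library's, but every norm, ball and
   difference quotient below uses the Euclidean structure dot, enorm. *)

Definition dot (R : realType) (n : nat) (u v : 'rV[R]_n) : R :=
  \sum_(i < n) u 0 i * v 0 i.

Definition enorm (R : realType) (n : nat) (u : 'rV[R]_n) : R :=
  Num.sqrt (dot u u).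

Definition eball (R : realType) (n : nat) (a : 'rV[R]_n) (eps : R) :
    set 'rV[R]_n :=
  [set x | enorm (x - a) <= eps].

Definition effdom (R : realType) (n : nat) (phi : 'rV[R]_n -> \bar R) :
    set 'rV[R]_n :=
  [set x | (phi x < +oo)%E].

(* Functions take values in \bar R, which contains -oo; properness excludes
   that value. *)
Definition proper_fun (R : realType) (n : nat) (phi : 'rV[R]_n -> \bar R) :
    Prop :=
  (forall x, phi x != -oo%E) /\ effdom phi !=set0.

Definition regular_subdiff (R : realType) (n : nat) (phi : 'rV[R]_n -> \bar R)
    (xbar : 'rV[R]_n) : set 'rV[R]_n :=
  [set v | effdom phi xbar /\
    (0 <= limf_einf (fun x => (phi x - phi xbar - (dot v (x - xbar))%:E)
                              * ((enorm (x - xbar))^-1)%:E) (xbar^'))%E].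

Definition limiting_subdiff (R : realType) (n : nat) (phi : 'rV[R]_n -> \bar R)
    (xbar : 'rV[R]_n) : set 'rV[R]_n :=
  [set v | effdom phi xbar /\
    exists (x_ v_ : nat -> 'rV[R]_n),
      [/\ x_ @ \oo --> xbar,
          (fun k => phi (x_ k)) @ \oo --> phi xbar,
          (forall k, regular_subdiff phi (x_ k) (v_ k)) &
          v_ @ \oo --> v]].

Definition eindicator (R : realType) (n : nat) (Omega : set 'rV[R]_n)
    (x : 'rV[R]_n) : \bar R :=
  if x \in Omega then 0%E else +oo%E.

Definition regular_normal_cone (R : realType) (n : nat)
    (Omega : set 'rV[R]_n) (x : 'rV[R]_n) : set 'rV[R]_n :=
  regular_subdiff (eindicator Omega) x.

Definition limiting_normal_cone (R : realType) (n : nat)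
    (Omega : set 'rV[R]_n) (x : 'rV[R]_n) : set 'rV[R]_n :=
  limiting_subdiff (eindicator Omega) x.

Definition gph (T U : Type) (F : T -> set U) : set (T * U) :=
  [set p | F p.1 p.2].

(* R^n x R^n is identified with R^(n + n), with its Euclidean structure, when
   normal cones to graphs are taken. *)
Definition flat (R : realType) (n : nat) (p : 'rV[R]_n * 'rV[R]_n) :
    'rV[R]_(n + n) :=
  row_mx p.1 p.2.
Arguments flat {R n} p.

Definition combined_subdiff2 (R : realType) (n : nat)
    (phi : 'rV[R]_n -> \bar R) (x y w : 'rV[R]_n) : set 'rV[R]_n :=
  [set z | regular_normal_cone (flat @` gph (limiting_subdiff phi))
             (flat (x, y)) (flat (z, - w))].

Definition limiting_subdiff2 (R : realType) (n : nat)
    (phi : 'rV[R]_n -> \bar R) (x y w : 'rV[R]_n) : set 'rV[R]_n :=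
  [set z | limiting_normal_cone (flat @` gph (limiting_subdiff phi))
             (flat (x, y)) (flat (z, - w))].

(* The library's convex_function only covers real-valued functions. *)
Definition econvex_on (R : realType) (n : nat) (U : set 'rV[R]_n)
    (f : 'rV[R]_n -> \bar R) : Prop :=
  forall (x y : 'rV[R]_n) (t : R), U x -> U y -> 0 <= t <= 1 ->
    (f (t *: x + (1 - t) *: y)%R <= t%:E * f x + (1 - t)%:E * f y)%E.

Definition strongly_convex_on (R : realType) (n : nat) (U : set 'rV[R]_n)
    (sigma : R) (f : 'rV[R]_n -> \bar R) : Prop :=
  econvex_on U (fun x => f x - (sigma / 2 * enorm x ^+ 2)%:E)%E.

Definition variationally_strongly_convex (R : realType) (n : nat)
    (phi : 'rV[R]_n -> \bar R) (xbar vbar : 'rV[R]_n) (sigma : R) : Prop :=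
  exists U V : set 'rV[R]_n,
    [/\ nbhs xbar U, nbhs vbar V,
        convex_set (U : set (convex_lmodType 'rV[R]_n)),
        convex_set (V : set (convex_lmodType 'rV[R]_n)) &
    exists (psi : 'rV[R]_n -> \bar R) (eps : R),
      let Ueps := [set x | U x /\ (phi x < phi xbar + eps%:E)%E] in
      [/\ proper_fun psi /\ lower_semicontinuous psi,
          (forall x, U x -> psi x <= phi x)%E /\
            strongly_convex_on U sigma psi,
          0 < eps,
          (Ueps `*` V) `&` gph (limiting_subdiff phi) =
            (U `*` V) `&` gph (limiting_subdiff psi) &
          forall x v, ((U `*` V) `&` gph (limiting_subdiff psi)) (x, v) ->
            phi x = psi x]].

Definition prox_regular (R : realType) (n : nat) (phi : 'rV[R]_n -> \bar R)
    (xbar vbar : 'rV[R]_n) : Prop :=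
  exists eps r : R, [/\ 0 < eps, 0 <= r &
    forall x u v : 'rV[R]_n,
      eball xbar eps x ->
      (gph (limiting_subdiff phi) `&` (eball xbar eps `*` eball vbar eps))
        (u, v) ->
      (phi u < phi xbar + eps%:E)%E ->
      (phi u + (dot v (x - u))%:E - (r / 2 * enorm (x - u) ^+ 2)%:E
         <= phi x)%E].

Definition subdiff_continuous (R : realType) (n : nat)
    (phi : 'rV[R]_n -> \bar R) (xbar vbar : 'rV[R]_n) : Prop :=
  forall eps : R, 0 < eps -> exists2 delta : R, 0 < delta &
    forall x v : 'rV[R]_n,
      (gph (limiting_subdiff phi) `&` (eball xbar delta `*` eball vbar delta))
        (x, v) ->
      (`| phi x - phi xbar | < eps%:E)%E.

(* Main.v *)
Require Import Defs.
From mathcomp Require Import all_boot all_order all_algebra.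
From mathcomp Require Import all_classical all_reals.
From mathcomp Require Import ereal topology normedtype sequences convex.
From mathcomp Require Import ring lra.
Import Order.TTheory GRing.Theory Num.Theory.
Import numFieldNormedType.Exports.

(* (i) => (ii): at a point of the graph near (xbar, vbar) the subgradients of
   phi are those of the strongly convex psi, so the perturbed problems
   min psi + (1 - sigma)/2 |. - x|^2 - <y + t d, .> are solvable near x and give
   the resolvent of (the subdifferential) - sigma I along every direction d; as
   it is firmly nonexpansive, a regular normal (z, -w) satisfies
   <z, w> >= sigma |w|^2.
   (ii) => (iii): limiting normals are limits of regular ones.
   (iii) => (i): with phi prox-regular of constant r, u = J c solves
   c = v + (r + 1)(u - xbar), v in the subdifferential at u, for a map J that is
   nonexpansive near vbar.  A proximal subgradient w of <b, J .> yields a normal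
   to the graph, so (ii) gives kappa |w|^2 <= <b, w> with kappa = r + 1 + sigma,
   i.e. the proximal subgradients of 2 kappa <b, J .> - <b, .> have norm at most
   |b|.  A mean value inequality makes that function |b|-Lipschitz, and the
   choice b = 2 kappa (J c - J c') - (c - c') turns this into
   kappa |J c - J c'|^2 <= <c - c', J c - J c'>: the graph is strongly monotone
   near (xbar, vbar).  Strong monotonicity makes the quadratic minorants
   phi u + <v, . - u> + sigma/2 |. - u|^2 lie below phi near xbar, and psi is
   their supremum. *)

Set Implicit Arguments.
Unset Strict Implicit.
Unset Printing Implicit Defensive.

Local Open Scope classical_set_scope.
Local Open Scope ring_scope.

(** * Inner product and Euclidean norm *)

Section Euclidean.
Context {R : realType} {n : nat}.
Implicit Types (u v w x y z : 'rV[R]_n) (a : R).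

Lemma dotC u v : dot u v = dot v u.
Proof. by apply: eq_bigr => i _; rewrite mulrC. Qed.

Lemma dotDl u v w : dot (u + v) w = dot u w + dot v w.
Proof. by rewrite -big_split; apply: eq_bigr => i _; rewrite mxE mulrDl. Qed.

Lemma dotZl a u v : dot (a *: u) v = a * dot u v.
Proof. by rewrite /dot mulr_sumr; apply: eq_bigr => i _; rewrite mxE mulrA. Qed.

Lemma dotNl u v : dot (- u) v = - dot u v.
Proof. by rewrite -scaleN1r dotZl mulN1r. Qed.

Lemma dotDr u v w : dot w (u + v) = dot w u + dot w v.
Proof. by rewrite !(dotC w) dotDl. Qed.

Lemma dotZr a u v : dot v (a *: u) = a * dot v u.
Proof. by rewrite !(dotC v) dotZl. Qed.

Lemma dotNr u v : dot v (- u) = - dot v u.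
Proof. by rewrite !(dotC v) dotNl. Qed.

Lemma dot0l v : dot 0 v = 0.
Proof. by rewrite -(scale0r 0) dotZl mul0r. Qed.

Lemma dot0r v : dot v 0 = 0.
Proof. by rewrite dotC dot0l. Qed.

Definition dotE := (dotDl, dotDr, dotNl, dotNr, dotZl, dotZr, dot0l, dot0r).

Lemma dot_ge0 u : 0 <= dot u u.
Proof. by apply: sumr_ge0 => i _; rewrite -expr2 sqr_ge0. Qed.

Lemma enorm_ge0 u : 0 <= enorm u.
Proof. exact: sqrtr_ge0. Qed.
Hint Resolve enorm_ge0 : core.

Lemma enorm_sq u : enorm u ^+ 2 = dot u u.
Proof. by rewrite sqr_sqrtr ?dot_ge0. Qed.

Lemma enorm_le a u : 0 <= a -> (enorm u <= a) = (dot u u <= a ^+ 2).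
Proof. by move=> a0; rewrite -enorm_sq ler_pXn2r ?nnegrE. Qed.

Lemma enorm0 : enorm (0 : 'rV[R]_n) = 0.
Proof. by rewrite /enorm dot0l sqrtr0. Qed.

Lemma enorm_eq0 u : (enorm u == 0) = (u == 0).
Proof.
apply/idP/eqP => [/eqP u0|->]; last by rewrite enorm0.
have : dot u u = 0 by rewrite -enorm_sq u0 expr0n.
move=> /eqP; rewrite psumr_eq0; last by move=> i _; rewrite -expr2 sqr_ge0.
move=> /allP u0'; apply/rowP => i; rewrite mxE.
by have := u0' i (mem_index_enum i); rewrite mulf_eq0 orbb => /eqP.
Qed.

Lemma enorm_gt0 u : (0 < enorm u) = (u != 0).
Proof. by rewrite lt_def enorm_ge0 andbT enorm_eq0. Qed.

Lemma enormN u : enorm (- u) = enorm u.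
Proof. by rewrite /enorm !dotE opprK. Qed.

Lemma enormZ a u : enorm (a *: u) = `|a| * enorm u.
Proof. by rewrite /enorm !dotE mulrA -expr2 sqrtrM ?sqr_ge0// sqrtr_sqr. Qed.

Lemma enormBC u v : enorm (u - v) = enorm (v - u).
Proof. by rewrite -enormN opprB. Qed.

(** Cauchy-Schwarz, by expanding the square of [enorm v *: u - enorm u *: v] and dividing by
    [enorm u * enorm v]. *)
Lemma dot_le_enorm u v : dot u v <= enorm u * enorm v.
Proof.
have [->|u0] := eqVneq u 0; first by rewrite dot0l enorm0 mul0r.
have [->|v0] := eqVneq v 0; first by rewrite dot0r enorm0 mulr0.
have := dot_ge0 ((enorm v)*: u - (enorm u) *: v).
rewrite !dotE (dotC v u) -!enorm_sq.
have : 0 < enorm u * enorm v by rewrite mulr_gt0 ?enorm_gt0.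
set a := enorm u; set b := enorm v; set d := dot u v => ab0 H.
rewrite -(ler_pM2l ab0); lra.
Qed.

Lemma dot_ge_enorm u v : - (enorm u * enorm v) <= dot u v.
Proof. by have := dot_le_enorm (- u) v; rewrite dotNl enormN lerNl. Qed.

Lemma enormD u v : enorm (u + v) <= enorm u + enorm v.
Proof.
rewrite enorm_le ?addr_ge0// !dotE (dotC v u) -!enorm_sq.
have := dot_le_enorm u v; lra.
Qed.

Lemma enorm_triangle v u w : enorm (u - w) <= enorm (u - v) + enorm (v - w).
Proof. by rewrite -{1}(subrK v u) -addrA enormD. Qed.

Lemma coord_le_enorm u i : `|u 0 i| <= enorm u.
Proof.
rewrite -(ler_pXn2r (_ : 0 < 2)%N) ?nnegrE// enorm_sq real_normK ?num_real//.
rewrite /dot (bigD1 i)//= -expr2 lerDl.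
by apply: sumr_ge0 => j _; rewrite -expr2 sqr_ge0.
Qed.

Lemma norm_le_enorm u : `|u| <= enorm u.
Proof.
rewrite /Num.norm/= mx_normrE; apply: bigmax_le => // -[i j] _ /=.
by rewrite (ord1 i) coord_le_enorm.
Qed.

Lemma enorm_le_norm u : enorm u <= n%:R * `|u|.
Proof.
rewrite enorm_le ?mulr_ge0//.
apply: (@le_trans _ _ (\sum_(i < n) `|u| ^+ 2)).
  apply: ler_sum => i _; rewrite -expr2 -real_normK ?num_real//.
  rewrite ler_pXn2r ?nnegrE//.
  rewrite {2}/Num.norm/= mx_normrE.
  exact: (le_bigmax_cond _ (fun ij : 'I_1 * 'I_n => `|u ij.1 ij.2|)
    (j := (0, i))).
rewrite sumr_const card_ord exprMn -[leLHS]mulr_natl ler_wpM2r ?sqr_ge0//.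
by rewrite -natrX ler_nat; case: (n) => // m; rewrite leq_pmulr.
Qed.

End Euclidean.

(** * Euclidean balls and the topology of the sup norm *)

Section EuclideanTopology.
Context {R : realType} {n : nat}.
Implicit Types (u v w x y z : 'rV[R]_n) (A : set 'rV[R]_n).

Lemma nbhs_eball x A :
  nbhs x A <-> exists2 d, 0 < d & forall y, enorm (y - x) <= d -> A y.
Proof.
split=> [/(nbhs_normP x A).1[e /= e0 xA]|[d d0 dA]].
  exists (e / 2) => [|y yx]; first by rewrite divr_gt0.
  apply: xA; rewrite /ball_/= distrC.
  by apply: le_lt_trans (norm_le_enorm _) _; lra.
(* [n.+1] rather than [n] keeps the radius positive in dimension 0. *)
apply/(nbhs_normP x A).2; exists (d / n.+1%:R) => [|y /=];
  first by rewrite /= divr_gt0.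
rewrite distrC ltr_pdivlMr// => /ltW yx; apply: dA.
apply: le_trans yx; apply: le_trans (enorm_le_norm _) _.
by rewrite mulrC ler_wpM2l// ler_nat.
Qed.

Lemma enorm_continuousP (f : 'rV[R]_n -> R) :
  (forall x e, 0 < e -> exists2 d, 0 < d &
    forall y, enorm (y - x) <= d -> `|f y - f x| <= e) -> continuous f.
Proof.
move=> H x A /nbhs_ballP[e /= e0 eA].
have [d d0 dA] := H x (e / 2) (divr_gt0 e0 (ltr0Sn _ 1)).
apply/nbhs_eball; exists d => // y /dA yx; apply: eA; rewrite /ball/= distrC.
by apply: le_lt_trans yx _; lra.
Qed.

Lemma enormB_lip x y z : enorm (y - z) - enorm (x - z) <= enorm (y - x).
Proof. by rewrite lerBlDr; exact: enorm_triangle. Qed.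

Lemma enormB_continuous u : continuous (fun y => enorm (y - u)).
Proof.
apply: enorm_continuousP => x e e0; exists e => // y yx.
have := enormB_lip x y u; have := enormB_lip y x u; rewrite (enormBC x y).
by rewrite ler_norml => ? ?; lra.
Qed.

Lemma dot_continuous v : continuous (dot v).
Proof.
apply: enorm_continuousP => x e e0.
have v0 := enorm_ge0 v; have v1 : 0 < enorm v + 1 by lra.
exists (e / (enorm v + 1)) => [|y]; first by rewrite divr_gt0.
rewrite ler_pdivlMr// => yx.
rewrite -dotNr -dotDr.
have := dot_le_enorm v (y - x); have := dot_ge_enorm v (y - x).
have := enorm_ge0 (y - x) => *.
rewrite ler_norml; nra.
Qed.

Lemma cvg_enorm (x_ : nat -> 'rV[R]_n) x : x_ @ \oo --> x <->
  forall e, 0 < e -> \forall k \near \oo, enorm (x_ k - x) <= e.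
Proof.
split=> [xx e e0|H A /nbhs_eball[d d0 dA]].
  have : nbhs x (eball x e) by apply/nbhs_eball; exists e.
  exact: xx.
by near=> k; apply: dA; near: k; exact: H.
Unshelve. all: end_near. Qed.

Lemma cvg_dot (x_ y_ : nat -> 'rV[R]_n) x y :
  x_ @ \oo --> x -> y_ @ \oo --> y ->
  (fun k => dot (x_ k) (y_ k)) @ \oo --> dot x y.
Proof.
move=> xx yy; rewrite /dot; apply: (@cvg_big R _ +%R 0 xpredT).
  exact: add_continuous.
move=> i _; apply: cvgM.
  exact: (continuous_cvg _ (@coord_continuous _ _ _ 0 i x) xx).
exact: (continuous_cvg _ (@coord_continuous _ _ _ 0 i y) yy).
Qed.

Lemma compact_eball x d : compact (eball x d).
Proof.
apply: bounded_closed_compact.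
  exists (enorm x + d); split; first exact: num_real.
  move=> M dM y; rewrite /eball/= => yx; apply: le_trans (norm_le_enorm _) _.
  have := enormD x (y - x); rewrite [x + _]addrC subrK; lra.
apply: (@closed_comp _ _ (fun y => enorm (y - x)) [set r | r <= d]) => [y _|].
  exact: enormB_continuous.
exact: closed_le.
Qed.

End EuclideanTopology.

(** * Minimizers of lower semicontinuous functions on closed balls *)

Section LscMin.
Context {R : realType} {n : nat}.
Implicit Types (B : set 'rV[R]_n) (F : 'rV[R]_n -> \bar R) (k : 'rV[R]_n -> R).

(** Relative to [B], so that [proximal_lipschitz] can minimize a function that is controlled only on
    a ball. *)
Definition lsc_on B F := forall y, B y -> forall a : R, (a%:E < F y)%E ->
  exists2 d, 0 < d & forall z, B z -> enorm (z - y) <= d -> (a%:E < F z)%E.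

Lemma lower_semicontinuous_lsc_on B F : lower_semicontinuous F -> lsc_on B F.
Proof.
move=> lF y By a /lF[V /nbhs_eball[d d0 dV] aV]; exists d => // z _ /dV.
exact: aV.
Qed.

Lemma lte_dense_fin (x : \bar R) (a : R) : (a%:E < x)%E ->
  exists2 b : R, a < b & (b%:E < x)%E.
Proof.
case: x => [r| |]; rewrite ?ltNge ?leNye//= -?ltNge.
  rewrite lte_fin => ar; exists ((a + r) / 2); last rewrite lte_fin; lra.
by move=> _; exists (a + 1); [lra|rewrite ltry].
Qed.

Lemma lsc_onD B F k : lsc_on B F -> continuous k ->
  lsc_on B (fun y => F y + (k y)%:E)%E.
Proof.
move=> lF ck y By a; rewrite -lteBlDr// => /lte_dense_fin[b ab bF].
have [d1 d10 H1] := lF _ By _ bF.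
have : nbhs (k y) [set r | k y - (b - (a - k y)) < r].
  by apply: lt_nbhsr; lra.
move=> /(ck y)/nbhs_eball[d2 d20 H2].
exists (Num.min d1 d2) => [|z Bz]; first by rewrite lt_min d10.
rewrite le_min => /andP[/(H1 _ Bz) zb /H2 /= zk].
rewrite -lteBlDr//; apply: le_lt_trans zb; rewrite lee_fin; lra.
Qed.

(** The sublevel sets of [F] in the ball generate a proper filter; by compactness it has a cluster
    point [y]. If [F z < F y], then [F] stays above a real [a >= F z] near [y], so the sublevel set
    of [z] misses a neighborhood of [y]. *)
Lemma lsc_on_argmin x d F : 0 <= d -> lsc_on (eball x d) F ->
  exists2 y, eball x d y & forall z, eball x d z -> (F y <= F z)%E.
Proof.
move=> d0 lF; set B := eball x d.
have Bx : B x by rewrite /B /eball/= subrr enorm0.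
pose S : set_system 'rV[R]_n :=
  filter_from B (fun y => [set z | B z /\ (F z <= F y)%E]).
have SF : ProperFilter S.
  apply: filter_from_proper; last by move=> y By; exists y.
  apply: filter_from_filter; first by exists x.
  move=> y z By Bz; have [yz|zy] := leP (F y) (F z).
    by exists y => // w [Bw wy]; split; split=> //; exact: le_trans yz.
  by exists z => // w [Bw wz]; split; split=> //; exact: le_trans (ltW zy).
have SB : S B by exists x => // z [].
have [y [By yS]] := @compact_eball _ _ x d S SF SB.
exists y => // z Bz; rewrite leNgt; apply/negP => zy.
have [a za ay] : exists2 a : R, (F z <= a%:E)%E & (a%:E < F y)%E.
  move: zy; case: (F z) => [r| |]; [by exists r|by rewrite ltNge leey|].
  case: (F y) => [r _| _|]; last by rewrite ltxx.
    by exists (r - 1); rewrite ?leNye// lte_fin; lra.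
  by exists 0; rewrite ?leNye// ltry.
have [e e0 He] := lF _ By _ ay.
have Sz : S [set w | B w /\ (F w <= F z)%E] by exists z.
have ye : nbhs y (eball y e) by apply/nbhs_eball; exists e.
have [w [[Bw wz] /= wy]] := yS _ _ Sz ye.
by have := le_lt_trans (le_trans wz za) (He _ Bw wy); rewrite ltxx.
Qed.

End LscMin.

(** * Regular, proximal and limiting subgradients *)

Section Subgradients.
Context {R : realType} {n : nat}.
Implicit Types (phi : 'rV[R]_n -> \bar R) (x y z u v : 'rV[R]_n).

Lemma effdom_fin_num phi x : (forall z, phi z != -oo%E) ->
  effdom phi x -> phi x \is a fin_num.
Proof. by move=> phiNy xd; rewrite fin_numE phiNy lt_eqF. Qed.

(** Clears the denominator of the difference quotient. Full balls replace punctured ones, since the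
    inequality is trivial at [y = x]. *)
Lemma regular_subdiffP phi x v : (forall z, phi z != -oo%E) ->
  regular_subdiff phi x v <-> effdom phi x /\
  forall e, 0 < e -> exists2 d, 0 < d & forall y, enorm (y - x) <= d ->
    ((fine (phi x) + dot v (y - x) - e * enorm (y - x))%:E <= phi y)%E.
Proof.
move=> phiNy; rewrite /regular_subdiff/= limf_einfE; split=> -[xd H];
  split=> //.
  move=> e e0; have xfin := effdom_fin_num phiNy xd.
  have : ((- e)%:E < 0 :> \bar R)%E by rewrite lte_fin; lra.
  move=> /lt_le_trans /(_ H) /ereal_sup_gt[_ [A xA <-]] eA.
  move: xA; rewrite /dnbhs/within/= => /nbhs_eball[d d0 dA].
  exists d => // y yd; have [->|yx] := eqVneq y x.
    by rewrite subrr dot0r enorm0 mulr0 addr0 subr0 fineK.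
  have yx0 : 0 < enorm (y - x) by rewrite enorm_gt0 subr_eq0.
  have := lt_le_trans eA (ereal_inf_lbound (imageP _ (dA _ yd yx))).
  case: (phi x) xfin (phiNy y) => // r _; case: (phi y) => [s _||]//=;
    last first.
    by rewrite leey.
  rewrite -EFinB -EFinM lte_fin lee_fin ltr_pdivlMr//; lra.
apply/lee_subgt0Pr => e e0; rewrite sub0e.
have [d d0 dphi] := H _ e0.
have xfin := effdom_fin_num phiNy xd.
apply: le_trans (ereal_sup_ubound _); last first.
  exists [set y | y != x /\ enorm (y - x) <= d]; last by [].
  by apply/nbhs_eball; exists d.
apply: le_ereal_inf_tmp => _ [y [yx yd] <-].
have yx0 : 0 < enorm (y - x) by rewrite enorm_gt0 subr_eq0.
have := dphi _ yd.
case: (phi x) xfin (phiNy y) => // r _; case: (phi y) => [s _||]//=.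
  by rewrite -!EFinB -EFinM !lee_fin ler_pdivlMr//; lra.
by move=> _ _; rewrite !addye// mulyr gtr0_sg ?invr_gt0// mul1e leey.
Qed.

(** [C] may be negative, so minorants that curve upwards are covered too. *)
Definition proximal_subdiff phi x v := phi x \is a fin_num /\
  exists C : R, exists2 d, 0 < d & forall y, enorm (y - x) <= d ->
    ((fine (phi x) + dot v (y - x) - C * enorm (y - x) ^+ 2)%:E <= phi y)%E.

Lemma proximal_regular phi x v : (forall z, phi z != -oo%E) ->
  proximal_subdiff phi x v -> regular_subdiff phi x v.
Proof.
move=> phiNy [xfin [C [d d0 dphi]]]; apply/regular_subdiffP => //.
split=> [|e e0]; first by rewrite /effdom/= ltey_eq xfin.
have C1 : 0 < `|C| + 1 by rewrite ltr_wpDl.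
exists (Num.min d (e / (`|C| + 1))) => [|y];
  first by rewrite lt_min d0 divr_gt0.
rewrite le_min ler_pdivlMr// => /andP[yd ye].
apply: le_trans (dphi _ yd); rewrite lee_fin.
have := ler_norm C; have := enorm_ge0 (y - x); nra.
Qed.

Lemma regular_limiting phi x v :
  regular_subdiff phi x v -> limiting_subdiff phi x v.
Proof.
move=> xv; split; first by case: xv.
by exists (fun=> x), (fun=> v); split=> //; exact: cvg_cst.
Qed.

Lemma eindicator_neqNy (Omega : set 'rV[R]_n) z : eindicator Omega z != -oo%E.
Proof. by rewrite /eindicator; case: ifP. Qed.

Lemma effdom_eindicator (Omega : set 'rV[R]_n) x :
  effdom (eindicator Omega) x <-> Omega x.
Proof.
rewrite /effdom/= /eindicator; split=> [|Ox]; last by rewrite mem_set// ltry.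
by case: ifPn => [/set_mem//|]; rewrite ltxx.
Qed.

Lemma regular_normal_coneP (Omega : set 'rV[R]_n) x v :
  regular_normal_cone Omega x v <-> Omega x /\
  forall e, 0 < e -> exists2 d, 0 < d &
    forall y, Omega y -> enorm (y - x) <= d ->
    dot v (y - x) <= e * enorm (y - x).
Proof.
rewrite /regular_normal_cone regular_subdiffP; last exact: eindicator_neqNy.
rewrite effdom_eindicator.
split=> -[Ox H]; split=> // e /H[d d0 dO]; exists d => // y.
  move=> Oy /dO; rewrite /eindicator !mem_set//= lee_fin add0r; lra.
move=> yd; rewrite /eindicator (mem_set Ox)/=.
case: ifPn => [/set_mem Oy|]; last by rewrite leey.
by rewrite lee_fin add0r subr_le0; exact: dO.
Qed.

End Subgradients.

(** * Proximal subgradients at penalized minima *)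

Section PenalizedMinima.
Context {R : realType} {n : nat}.
Implicit Types (F phi : 'rV[R]_n -> \bar R) (x y z u v w : 'rV[R]_n).

Lemma enormB_sq_continuous u : continuous (fun y => enorm (y - u) ^+ 2).
Proof.
move=> y; apply: (@continuousM R _ (fun y => enorm (y - u))
  (fun y => enorm (y - u))).
  exact: enormB_continuous.
exact: enormB_continuous.
Qed.

Lemma dotB_continuous v u : continuous (fun y => dot v (y - u)).
Proof.
have -> : (fun y => dot v (y - u)) = (fun y => dot v y - dot v u).
  by apply/funext => y; rewrite !dotE.
by move=> y; apply: continuousB; [exact: dot_continuous|exact: cst_continuous].
Qed.

(** The quadratic upper bound for the C^{1,1} function [t -> (max 0 t)^2], whose derivative at [a]
    is [2 * max 0 a]. *)
Lemma max0_sq_le (a b : R) : Num.max 0 b ^+ 2 <=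
  Num.max 0 a ^+ 2 + 2 * Num.max 0 a * (b - a) + (b - a) ^+ 2.
Proof.
have := sqr_ge0 a; have := sqr_ge0 b; have := sqr_ge0 (b - a).
case: (leP 0 a) => a0; case: (leP 0 b) => b0; rewrite ?expr0n/=; nra.
Qed.

(* The penalty [M (max 0 (|y-u|^2 - s^2))^2] vanishes at [u] and [x] and keeps
   the minimizer off the boundary of the ball of radius [2s]. *)
Lemma descent_point F u x (B : R) :
  lsc_on (eball u (2 * enorm (x - u))) F -> (forall z, F z != -oo%E) ->
  0 <= B -> F u \is a fin_num -> (F x < F u)%E ->
  (forall y, eball u (2 * enorm (x - u)) y -> ((fine (F u) - B)%:E <= F y)%E) ->
  exists y (m : R), [/\ 0 < enorm (y - u), enorm (y - u) < 2 * enorm (x - u),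
    0 <= m, m * enorm (x - u) ^+ 2 <= 2 * B &
    proximal_subdiff F y (- m *: (y - u))].
Proof.
set s := enorm (x - u) => lF FNy B0 ufin xu FB.
have s0 : 0 < s.
  by rewrite /s enorm_gt0 subr_eq0; apply: contraTN xu => /eqP->; rewrite ltxx.
(* On the sphere of radius [2 * s] the excess [P] is [3 * s^2], so the penalty is exactly [B] there
   and [F + k >= F u], which the minimizer violates. *)
pose M := B / (9 * s ^+ 4).
have s20 : 0 < s ^+ 2 by rewrite exprn_gt0.
have s40 : 0 < s ^+ 4 by rewrite exprn_gt0.
have ME : M * (9 * s ^+ 4) = B by rewrite /M divfK// gt_eqF// mulr_gt0.
have M0 : 0 <= M by rewrite /M divr_ge0// mulr_ge0// ltW.
pose P y := Num.max 0 (enorm (y - u) ^+ 2 - s ^+ 2).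
have P0 y : 0 <= P y by rewrite /P le_max lexx.
pose k y := M * P y ^+ 2.
have k0 y : 0 <= k y by rewrite /k mulr_ge0// sqr_ge0.
have ck : continuous k.
  have cP : continuous P.
    apply: max_fun_continuous; first exact: cst_continuous.
    have cS : continuous (fun y => enorm (y - u) ^+ 2 - s ^+ 2).
      by move=> y; exact: (cvgB (@enormB_sq_continuous u y) (cvg_cst _)).
    exact: cS.
  by move=> y; exact: (cvgM (cvg_cst M) (cvgM (cP y) (cP y))).
have [||y By ymin] := @lsc_on_argmin _ _ u (2 * s) (fun y => F y + (k y)%:E)%E.
- by rewrite mulr_ge0 ?ltW.
- exact: lsc_onD.
have Bx : eball u (2 * s) x by rewrite /eball/= -/s; lra.
have kx : k x = 0.
  by rewrite /k /P -/s subrr maxxx expr0n mulr0.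
have yu : (F y + (k y)%:E < F u)%E.
  by apply: le_lt_trans (ymin _ Bx) _; rewrite kx adde0.
have yfin : F y \is a fin_num.
  rewrite fin_numE FNy/=; apply/negP => /eqP yoo.
  by move: yu; rewrite yoo ltNge leey.
have yu' : fine (F y) + k y < fine (F u).
  by move: yu; case: (F y) yfin => // r _; case: (F u) ufin.
have y2s : enorm (y - u) < 2 * s.
  rewrite lt_neqAle By andbT; apply/eqP => ys.
  have : k y = B.
    rewrite /k /P ys (_ : Num.max _ _ = 3 * s ^+ 2); first by rewrite -ME; ring.
    by rewrite maxEle; case: ifP => //; nra.
  have := FB _ By; case: (F y) yfin yu' => //= r _ + + ky.
  rewrite lee_fin ky; lra.
(* The gradient of the penalty [M * P^2] at [y] is [4 * M * P y *: (y - u)]; [P y <= 3 * s^2] bounds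
   its coefficient. *)
exists y, (4 * M * P y); split=> //.
- rewrite enorm_gt0 subr_eq0; apply: contraTN yu => /eqP->.
  by rewrite -leNgt leeDl// lee_fin.
- by apply: mulr_ge0 (P0 y); apply: mulr_ge0.
- have : P y <= 3 * s ^+ 2.
    rewrite /P ge_max; apply/andP; split; first by rewrite mulr_ge0// ltW.
    by have := enorm_ge0 (y - u); move: (y2s); nra.
  rewrite -ME => Py.
  have : 0 <= M * s ^+ 2 * (3 * s ^+ 2 - P y).
    by apply: mulr_ge0; [exact: mulr_ge0 (ltW s20)|rewrite subr_ge0].
  have : 0 <= M * s ^+ 4 by rewrite mulr_ge0// ltW.
  lra.
(* With [e = |z - y| <= 1] and [|y - u| < 2 * s], the increment [2 <y - u, z - y> + e^2] of the
   squared distance is at most [(4 * s + 1) * e] in absolute value; [max0_sq_le] then gives this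
   constant. *)
split=> //; exists (2 * M * P y + M * (4 * s + 1) ^+ 2).
exists (Num.min (2 * s - enorm (y - u)) 1).
  by rewrite lt_min ltr01 andbT subr_gt0.
move=> z; rewrite le_min => /andP[zy1 zy2].
have Bz : eball u (2 * s) z.
  by have := enorm_triangle y z u; rewrite /eball/=; lra.
have H : k z - k y <= 4 * M * P y * dot (y - u) (z - y) +
    (2 * M * P y + M * (4 * s + 1) ^+ 2) * enorm (z - y) ^+ 2.
  have -> : k z - k y = M * (P z ^+ 2 - P y ^+ 2) by rewrite /k; ring.
  have := max0_sq_le (enorm (y - u) ^+ 2 - s ^+ 2)
    (enorm (z - u) ^+ 2 - s ^+ 2).
  rewrite -/(P y) -/(P z).
  have -> : enorm (z - u) ^+ 2 - s ^+ 2 - (enorm (y - u) ^+ 2 - s ^+ 2) =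
      2 * dot (y - u) (z - y) + enorm (z - y) ^+ 2.
    move: (s ^+ 2) => c; rewrite !enorm_sq !dotE (dotC y z) (dotC u z)
      (dotC u y).
    by ring.
  have := dot_le_enorm (y - u) (z - y); have := dot_ge_enorm (y - u) (z - y).
  have := enorm_ge0 (y - u); have := enorm_ge0 (z - y).
  move: y2s zy2 M0.
  set g := dot _ _; set e := enorm (z - y); set t := enorm (y - u).
  set p := P z; set q := P y => ts e1 M0' e0 t0 g1 g2 H.
  have ge : (2 * g + e ^+ 2) ^+ 2 <= (4 * s + 1) ^+ 2 * e ^+ 2.
    rewrite -exprMn -[leRHS]real_normK ?num_real//
      -[leLHS]real_normK ?num_real//.
    rewrite ler_pXn2r ?nnegrE// [leRHS]ger0_norm;
      last by rewrite mulr_ge0//; lra.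
    by rewrite ler_norml; nra.
  have : 0 <= M * (2 * q * (2 * g + e ^+ 2) + (4 * s + 1) ^+ 2 * e ^+ 2 -
     (p ^+ 2 - q ^+ 2)) by rewrite mulr_ge0//; lra.
  lra.
have := ymin _ Bz; rewrite dotZl.
case: (F y) yfin => // r _; case: (F z) (FNy z) => // [r' _|_ _].
  rewrite -!EFinD !lee_fin/=; lra.
by rewrite leey.
Qed.

End PenalizedMinima.

(** * Perturbed problems, a mean value inequality, and strong convexity *)

Section ProximalCalculus.
Context {R : realType} {n : nat}.
Implicit Types (phi psi : 'rV[R]_n -> \bar R) (x y z u v w d : 'rV[R]_n).
Implicit Types (U : set 'rV[R]_n).

(** Minimize [phi + lambda/2 |. - x|^2 - <y + d, . - x>] over the ball. Comparing the value at the
    minimizer [u] with that at [x], the minorant gives [|u - x|^2 / 2 <= <d, u - x>], so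
    [|u - x| <= 2|d|] and the minimizer is interior. *)
Lemma perturbed_solution phi x y d (lambda delta : R) :
  lower_semicontinuous phi -> (forall z, phi z != -oo%E) ->
  phi x \is a fin_num ->
  (forall u, eball x delta u ->
    ((fine (phi x) + dot y (u - x) + (1 - lambda) / 2 * enorm (u - x) ^+ 2)%:E
      <= phi u)%E) ->
  2 * enorm d < delta ->
  exists2 u, enorm (u - x) <= 2 * enorm d &
    proximal_subdiff phi u (y + d - lambda *: (u - x)).
Proof.
move=> lphi phiNy xfin H ddelta; have d0 := enorm_ge0 d.
pose k u := lambda / 2 * enorm (u - x) ^+ 2 - dot (y + d) (u - x).
have ck : continuous k.
  move=> u; exact: (cvgB (cvgM (cvg_cst (lambda / 2))
    (@enormB_sq_continuous _ _ x u))
                         (@dotB_continuous _ _ (y + d) x u)).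
have [||u Bu umin] := @lsc_on_argmin _ _ x delta (fun u => phi u + (k u)%:E)%E.
- by lra.
- by apply: lsc_onD ck; exact: lower_semicontinuous_lsc_on.
have Bx : eball x delta x by rewrite /eball/= subrr enorm0; lra.
have kx : k x = 0 by rewrite /k subrr enorm0 dot0r expr0n mulr0 subrr.
have ux := umin _ Bx; rewrite kx adde0 in ux.
have ufin : phi u \is a fin_num.
  rewrite fin_numE phiNy/=; apply/negP => /eqP uoo.
  by move: ux; rewrite uoo leNgt ltey_eq xfin.
have ud : enorm (u - x) <= 2 * enorm d.
  have := H _ Bu; move: ux; rewrite /k dotDl.
  case: (phi x) xfin => // r _; case: (phi u) ufin => // s _ /=.
  rewrite -EFinD !lee_fin => h1 h2.
  have du := dot_le_enorm d (u - x).
  have [u0|u0] := leP (enorm (u - x)) 0; first lra.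
  have : enorm (u - x) ^+ 2 <= enorm (u - x) * (2 * enorm d) by lra.
  by rewrite expr2 ler_pM2l.
exists u => //; split=> //.
exists (lambda / 2), (delta - enorm (u - x)); first by lra.
move=> z zu; have Bz : eball x delta z.
  by have := enorm_triangle u z x; rewrite /eball/=; lra.
have := umin _ Bz.
case: (phi u) ufin => // s _; case: (phi z) (phiNy z) => // [t _|_ _];
  last first.
  by rewrite leey.
rewrite -!EFinD !lee_fin /k/= !enorm_sq !dotE.
by rewrite (dotC u z) (dotC x z) (dotC x u); lra.
Qed.

(** The inequality [2 t |z - u| <= t^2 + |z - u|^2] at [t = |y - u|], with [|z - u|^2] expanded
    around [y]: the norm has a quadratic upper model away from its kink. *)
Lemma enorm_tangent u y z : 0 < enorm (y - u) ->
  enorm (z - u) <= enorm (y - u) + dot (y - u) (z - y) / enorm (y - u) +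
    enorm (z - y) ^+ 2 / (2 * enorm (y - u)).
Proof.
set t := enorm (y - u) => t0.
have -> : t + dot (y - u) (z - y) / t + enorm (z - y) ^+ 2 / (2 * t) =
    (t ^+ 2 + enorm (z - u) ^+ 2) / (2 * t).
  have t1 : t != 0 by rewrite gt_eqF.
  have -> : enorm (z - u) ^+ 2 = t ^+ 2 + 2 * dot (y - u) (z - y) +
      enorm (z - y) ^+ 2.
    rewrite /t !enorm_sq !dotE (dotC y z) (dotC u z) (dotC u y); ring.
  by field.
rewrite ler_pdivlMr; last by rewrite mulr_gt0.
have := sqr_ge0 (enorm (z - u) - t); lra.
Qed.

(* At a local minimizer of [f + L' |. - x|] other than [x], the penalty is
   differentiable and provides a proximal subgradient of [f] of norm [>= L']. *)
Lemma proximal_lipschitz (f : 'rV[R]_n -> R) c (rho K L : R) :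
  0 <= K -> 0 <= L ->
  (forall x y, eball c (5 * rho) x -> eball c (5 * rho) y ->
    f x - f y <= K * enorm (x - y)) ->
  (forall x w, enorm (x - c) < 5 * rho ->
    proximal_subdiff (EFin \o f) x w -> enorm w <= L) ->
  forall x y, eball c rho x -> eball c rho y -> f x - f y <= L * enorm (x - y).
Proof.
move=> K0 L0 fK fL u x Bu Bx; rewrite leNgt; apply/negP; rewrite enormBC.
set s := enorm (x - u) => Lf.
have s0 : 0 < s.
  rewrite /s enorm_gt0 subr_eq0; apply: contraTN Lf => /eqP xu.
  by rewrite /s xu !subrr enorm0 mulr0 ltxx.
(* [L'] is the midpoint between [L] and the slope of [f] from [x] to [u]. *)
have [L' LL' L'f] : exists2 L' : R, L < L' & L' * s < f u - f x.
  exists ((L + (f u - f x) / s) / 2).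
    by have : L < (f u - f x) / s by [rewrite ltr_pdivlMr]; lra.
  have : (f u - f x) / s * s = f u - f x by rewrite divfK// gt_eqF.
  lra.
have s2 : s <= 2 * rho.
  have := enorm_triangle c x u; move: Bu Bx;
    rewrite /eball/= (enormBC c u) -/s; lra.
(* [u] is within [rho] of [c] and [2 * s <= 4 * rho], whence the factor 5. *)
have sub z : eball u (2 * s) z -> eball c (5 * rho) z.
  move: Bu; rewrite /eball/=; have := enorm_triangle u z c; lra.
have Bu' : eball u (2 * s) u by rewrite /eball/= subrr enorm0; lra.
pose F z : \bar R := ((f z)%:E + (L' * enorm (z - u))%:E)%E.
have Fu : F u = (f u)%:E by rewrite /F subrr enorm0 mulr0 adde0.
have [||||||y [m [y0 ys m0 _ [_ [C [e e0 yC]]]]]] := @descent_point R n F u x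
  (K * (2 * s)).
- apply: (@lsc_onD _ _ _ (EFin \o f) (fun z => L' * enorm (z - u))).
    move=> y By a /=; rewrite lte_fin => ay.
    have K1 : 0 < K + 1 by lra.
    exists ((f y - a) / (2 * (K + 1))) => [|z Bz].
      by rewrite divr_gt0 ?mulr_gt0//; lra.
    rewrite ler_pdivlMr ?mulr_gt0// lte_fin => zy.
    have := fK _ _ (sub _ By) (sub _ Bz); rewrite enormBC.
    have := enorm_ge0 (z - y); nra.
  by move=> y; exact: (cvgM (cvg_cst L') (@enormB_continuous _ _ u y)).
- by [].
- by rewrite mulr_ge0// mulr_ge0// ltW.
- by rewrite Fu.
- by rewrite Fu /F -EFinD lte_fin -/s; lra.
- move=> y By; rewrite Fu /F -EFinD lee_fin/=.
  have := fK _ _ (sub _ Bu') (sub _ By).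
  have : K * enorm (u - y) <= K * (2 * s) by rewrite ler_wpM2l// enormBC.
  have : 0 <= L' * enorm (y - u) by rewrite mulr_ge0 ?enorm_ge0//; lra.
  lra.
have yc : enorm (y - c) < 5 * rho.
  by move: Bu; rewrite /eball/=; have := enorm_triangle u y c;
    rewrite -/s in ys *; lra.
set t := enorm (y - u) in y0 ys.
have t1 : t != 0 by rewrite gt_eqF.
suff : enorm (- (m + L' / t) *: (y - u)) <= L.
  rewrite enormZ normrN ger0_norm; last first.
    by rewrite addr_ge0// divr_ge0 ?ltW//; lra.
  by rewrite -/t mulrDl divfK//; have := mulr_ge0 m0 (ltW y0); lra.
apply: (fL _ _ yc); split=> //; exists (C + L' / (2 * t)), e => // z /yC.
rewrite /F -!EFinD !lee_fin/= -/t !dotZl.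
have := @enorm_tangent u y z y0; rewrite -/t => tz.
have : L' * enorm (z - u) <=
    L' * (t + dot (y - u) (z - y) / t + enorm (z - y) ^+ 2 / (2 * t)).
  by rewrite ler_wpM2l//; lra.
have -> : L' / (2 * t) = L' * (1 / (2 * t)) by rewrite mul1r.
have -> : enorm (z - y) ^+ 2 / (2 * t) = enorm (z - y) ^+ 2 * (1 / (2 * t)).
  by rewrite mul1r.
lra.
Qed.

(** Compare the subgradient inequality at [x + t (y - x)] with strong convexity on the segment,
    divide by [t] and let [t] be small. *)
Lemma regular_strongly_convex psi U x y v (sigma : R) :
  (forall z, psi z != -oo%E) -> strongly_convex_on U sigma psi ->
  U x -> U y -> regular_subdiff psi x v ->
  ((fine (psi x) + dot v (y - x) + sigma / 2 * enorm (y - x) ^+ 2)%:E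
    <= psi y)%E.
Proof.
move=> psiNy cvx Ux Uy /(regular_subdiffP _ _ psiNy)[xd xv].
have xfin := effdom_fin_num psiNy xd.
case: (psi y) (psiNy y) (cvx y x) => // [s _|_ _]; last by rewrite leey.
move=> {}cvx; rewrite lee_fin; apply/ler_addgt0Pr => e e0.
set D := enorm (y - x); have D0 : 0 <= D := enorm_ge0 _.
(* After division by [t <= e'] the errors are [e' * D] and at most [e' * |sigma| / 2 * D^2]; this
   denominator makes their sum at most [e]. *)
have E0 : 0 < D + `|sigma| / 2 * D ^+ 2 + 1.
  by rewrite ltr_wpDl// addr_ge0// mulr_ge0// ?divr_ge0// sqr_ge0.
pose e' := e / (D + `|sigma| / 2 * D ^+ 2 + 1).
have e'0 : 0 < e' by rewrite divr_gt0.
have e'E : e' * (D + `|sigma| / 2 * D ^+ 2 + 1) = e by rewrite divfK// gt_eqF.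
have [d d0 dpsi] := xv _ e'0.
pose t := Num.min (Num.min 1 e') (d / (D + 1)).
have D1 : 0 < D + 1 by lra.
have t0 : 0 < t by rewrite !lt_min ltr01 e'0 divr_gt0.
have [t1 te td] : [/\ t <= 1, t <= e' & t * (D + 1) <= d].
  by rewrite -ler_pdivlMr// /t !ge_min !lexx ?orbT.
have zx : t *: y + (1 - t) *: x - x = t *: (y - x).
  by apply/rowP => i; rewrite !mxE; ring.
have tD : t * D <= d by lra.
have := dpsi (t *: y + (1 - t) *: x).
rewrite zx dotZr enormZ ger0_norm ?(ltW t0)// -/D => /(_ tD) dz.
have := cvx t Uy Ux; rewrite (ltW t0) t1 => /(_ isT).
move: xfin dz; case: (psi x) => // r _ /=.
case: (psi (t *: y + (1 - t) *: x)) => [p| |]; last 2 first.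
- by move=> _; rewrite -!EFinB -!EFinM -EFinD leNgt ltry.
- by rewrite leNgt ltNye.
rewrite -!EFinB -!EFinM -EFinD !lee_fin => h1 h2.
have : sigma / 2 * enorm (t *: y + (1 - t) *: x) ^+ 2 = sigma / 2 *
  (t * enorm y ^+ 2 + (1 - t) * enorm x ^+ 2 - t * (1 - t) * D ^+ 2).
  by congr (_ * _); rewrite /D !enorm_sq !dotE (dotC x y); ring.
move=> h3; rewrite -(ler_pM2l t0).
have h4 : t * (sigma * (D ^+ 2)) <= e' * (`|sigma| * D ^+ 2).
  apply: (@le_trans _ _ (t * (`|sigma| * D ^+ 2))).
    by rewrite ler_pM2l// ler_wpM2r ?sqr_ge0// ler_norm.
  by rewrite ler_wpM2r// mulr_ge0// sqr_ge0.
have h5 : t * (t * (sigma * D ^+ 2)) <= t * (e' * (`|sigma| * D ^+ 2)).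
  by rewrite ler_pM2l.
have h6 : 0 < t * e' by rewrite mulr_gt0.
rewrite -e'E; lra.
Qed.

(** The approximating points end up in [U], a neighborhood of [x], and the inequality for regular
    subgradients is closed under limits. *)
Lemma limiting_strongly_convex psi U x y v (sigma : R) :
  (forall z, psi z != -oo%E) -> strongly_convex_on U sigma psi ->
  nbhs x U -> U y -> limiting_subdiff psi x v ->
  ((fine (psi x) + dot v (y - x) + sigma / 2 * enorm (y - x) ^+ 2)%:E
    <= psi y)%E.
Proof.
move=> psiNy cvx Ux Uy [xd [x_ [v_ [xx psix xv vv]]]].
have xfin := effdom_fin_num psiNy xd.
have : \forall k \near \oo, ((fine (psi (x_ k)) + dot (v_ k) (y - x_ k) +
    sigma / 2 * enorm (y - x_ k) ^+ 2)%:E <= psi y)%E.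
  have : \forall k \near \oo, U (x_ k) by exact: xx.
  by apply: filterS => k Uk; exact: (regular_strongly_convex psiNy cvx).
case: (psi y) (psiNy y) => // [s _|_ _]; last by rewrite leey.
under eq_near do rewrite lee_fin.
rewrite lee_fin => H; apply: (cvgr_to_le _ H).
rewrite enorm_sq; under eq_fun do rewrite enorm_sq.
have yx : (fun k => y - x_ k) @ \oo --> y - x by exact: (cvgB (cvg_cst y) xx).
apply: cvgD; last by apply: cvgM; [exact: cvg_cst|exact: cvg_dot].
apply: cvgD; last exact: cvg_dot.
by apply: fine_cvg; rewrite fineK.
Qed.

End ProximalCalculus.

(** * Normals to graphs of strongly monotone operators *)

Section GraphNormals.
Context {R : realType} {n : nat}.
Implicit Types (x y z u v w d a : 'rV[R]_n) (G : set ('rV[R]_n * 'rV[R]_n)).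

Lemma dot_flat x y u v : dot (flat (x, y)) (flat (u, v)) = dot x u + dot y v.
Proof.
rewrite /dot /flat/= big_split_ord/=; congr (_ + _); apply: eq_bigr => i _.
  by rewrite !row_mxEl.
by rewrite !row_mxEr.
Qed.

Lemma flatB x y u v : flat (x, y) - flat (u, v) = flat (x - u, y - v).
Proof. by rewrite /flat/= opp_row_mx add_row_mx. Qed.

Lemma enorm_flat_le x y : enorm (flat (x, y)) <= enorm x + enorm y.
Proof.
rewrite enorm_le ?addr_ge0 ?enorm_ge0// dot_flat -!enorm_sq.
by have := mulr_ge0 (enorm_ge0 x) (enorm_ge0 y); lra.
Qed.

Lemma enorm_le_flat x y :
  enorm x <= enorm (flat (x, y)) /\ enorm y <= enorm (flat (x, y)).
Proof.
rewrite !enorm_le ?enorm_ge0// enorm_sq dot_flat lerDl lerDr.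
by split; exact: dot_ge0.
Qed.

Lemma regular_normal_gphP G x y z w :
  regular_normal_cone (flat @` G) (flat (x, y)) (flat (z, w)) <-> G (x, y) /\
  forall e, 0 < e -> exists2 d, 0 < d & forall u v, G (u, v) ->
    enorm (u - x) <= d -> enorm (v - y) <= d ->
    dot z (u - x) + dot w (v - y) <= e * (enorm (u - x) + enorm (v - y)).
Proof.
have Gflat u v : (flat @` G) (flat (u, v)) <-> G (u, v).
  split=> [[[u' v'] G'] /eq_row_mx[/= <- <-]//|Guv]; by exists (u, v).
rewrite regular_normal_coneP Gflat; split=> -[Gxy H]; split=> // e e0.
  have [d d0 Hd] := H _ e0; exists (d / 2) => [|u v Guv ux vy].
    by rewrite divr_gt0.
  have := Hd _ ((Gflat u v).2 Guv); rewrite flatB dot_flat.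
  have uv := enorm_flat_le (u - x) (v - y) => /(_ _)/le_trans; apply; first lra.
  by rewrite ler_pM2l.
have [d d0 Hd] := H _ (divr_gt0 e0 (ltr0Sn _ 1)).
exists d => // _ [[u v] Guv <-]; rewrite flatB dot_flat.
have [ux vy] := enorm_le_flat (u - x) (v - y) => uvd.
apply: le_trans (Hd _ _ Guv (le_trans ux uvd) (le_trans vy uvd)) _.
have : e * (enorm (u - x) + enorm (v - y)) <=
    e * (2 * enorm (flat (u - x, v - y))).
  by rewrite ler_pM2l//; lra.
lra.
Qed.

(* With [T] the operator of graph [G], the hypothesis provides points of [G]
   along [x + (T - sigma I) x + t d], i.e. the resolvent of [T - sigma I],
   which is firmly nonexpansive; the claim is that regular normals to the graph
   of the latter have the sign of a monotone operator. *)
Lemma strong_monotone_coderivative G x y z w (sigma : R) :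
  regular_normal_cone (flat @` G) (flat (x, y)) (flat (z, - w)) ->
  (forall d, exists C, exists2 t0, 0 < t0 & forall t, 0 < t -> t <= t0 ->
    exists u v, [/\ G (u, v), enorm (u - x) <= C * t, enorm (v - y) <= C * t,
      v - y = t *: d - (1 - sigma) *: (u - x) &
      sigma * enorm (u - x) ^+ 2 <= dot (v - y) (u - x)]) ->
  sigma * enorm w ^+ 2 <= dot z w.
Proof.
move=> /regular_normal_gphP[Gxy N] H.
(* These two vectors satisfy [|a|^2 - |d|^2 = 4 (<z, w> - sigma |w|^2)], so the claim is
   [|d| <= |a|]. *)
pose d := z - (sigma + 1) *: w; pose a := z - (sigma - 1) *: w.
have [C [t0 t00 Ht]] := H d.
suff da : enorm d ^+ 2 <= enorm a * enorm d.
  have : enorm d ^+ 2 <= enorm a ^+ 2.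
    rewrite ler_pXn2r ?nnegrE ?enorm_ge0//.
    have [d0|d0] := leP (enorm d) 0; first exact: le_trans (enorm_ge0 a).
    by rewrite -(ler_pM2r d0) -expr2.
  by rewrite !enorm_sq /d /a !dotE (dotC w z); lra.
have aE : a = d + 2 *: w by apply/rowP => i; rewrite !mxE; ring.
have zE : z = a + (sigma - 1) *: w by apply/rowP => i; rewrite !mxE; ring.
move: zE aE Ht; clearbody d a => zE aE Ht.
apply/ler_addgt0Pr => e e0.
have C1 : 0 < 4 * (`|C| + 1) by rewrite mulr_gt0// ltr_wpDl.
(* The normal inequality has error [2 e' |C| t]; it is later multiplied by [2 / t]. *)
pose e' := e / (4 * (`|C| + 1)).
have e'0 : 0 < e' by rewrite divr_gt0.
have e'E : e' * (4 * (`|C| + 1)) = e by rewrite divfK// gt_eqF.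
have [r r0 Hr] := N _ e'0.
have C10 : 0 < `|C| + 1 by lra.
pose t := Num.min t0 (r / (`|C| + 1)).
have tt0 : 0 < t by rewrite lt_min t00 divr_gt0.
have [tle tr] : t <= t0 /\ t * (`|C| + 1) <= r.
  by rewrite -ler_pdivlMr// /t !ge_min !lexx ?orbT.
have CC : C * t <= `|C| * t by rewrite ler_wpM2r ?ler_norm// ltW.
have [u [v [Guv ux vy vE mono]]] := Ht _ tt0 tle.
have Cr : `|C| * t <= r by lra.
have := Hr _ _ Guv (le_trans ux (le_trans CC Cr))
  (le_trans vy (le_trans CC Cr)).
have : e' * (enorm (u - x) + enorm (v - y)) <= e' * (2 * (`|C| * t)).
  by rewrite ler_pM2l//; lra.
rewrite vE in mono *; move: (u - x) mono => p mono eC nor.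
(* Strong monotonicity reads [|p|^2 <= t <d, p>]: [p] lies in the ball with diameter from 0 to
   [t *: d]. *)
have pd : enorm (p - (t / 2) *: d) <= t / 2 * enorm d.
  rewrite enorm_le; last by rewrite mulr_ge0 ?enorm_ge0// divr_ge0// ltW.
  move: mono; rewrite exprMn !enorm_sq !dotE (dotC d p); lra.
have := dot_ge_enorm a (p - (t / 2) *: d).
have : enorm a * enorm (p - (t / 2) *: d) <= enorm a * (t / 2 * enorm d).
  by rewrite ler_wpM2l// enorm_ge0.
have adw : dot a d = enorm d ^+ 2 + 2 * dot w d by rewrite aE enorm_sq !dotE.
rewrite dotDr dotNr dotZr adw => h1 h2.
have h3 : dot z p = dot a p + (sigma - 1) * dot w p by rewrite zE !dotE.
move: nor; rewrite h3 dotNl dotDr dotNr !dotZr => h4.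
rewrite -(ler_pM2l tt0) -e'E.
have : 0 < t * e' by rewrite mulr_gt0.
lra.
Qed.

End GraphNormals.

(** * From variational strong convexity to the second-order conditions *)

Section Necessity.
Context {R : realType} {n : nat}.
Implicit Types (x y z u v w d xbar vbar : 'rV[R]_n).

Lemma fin_numB_lt (a b : \bar R) (e : R) : a \is a fin_num -> b \is a fin_num ->
  (`|a - b| < e%:E)%E = (`|fine a - fine b| < e).
Proof.
by case: a => // a _; case: b => // b _; rewrite -EFinB abse_EFin lte_fin.
Qed.

Lemma variationally_strongly_convex_second_order (phi : 'rV[R]_n -> \bar R)
    xbar vbar (sigma : R) :
  (forall z, phi z != -oo%E) -> effdom phi xbar ->
  subdiff_continuous phi xbar vbar ->
  variationally_strongly_convex phi xbar vbar sigma ->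
  0 < sigma ->
  prox_regular phi xbar vbar /\
  exists U V : set 'rV[R]_n, [/\ nbhs xbar U, nbhs vbar V &
    forall x y w z, combined_subdiff2 phi x y w z ->
      (gph (limiting_subdiff phi) `&` (U `*` V)) (x, y) ->
      sigma * enorm w ^+ 2 <= dot z w].
Proof.
move=> phiNy xd phi_sc [U [V [Ux Vv _ _ [psi [eps]]]]].
set Ueps := [set x | _] => -[[[psiNy _] lpsi] [psi_le cvx] eps0 gphE valE]
  sigma0.
have xfin := effdom_fin_num phiNy xd.
have in_psi x y : U x -> V y -> (phi x < phi xbar + eps%:E)%E ->
    limiting_subdiff phi x y -> limiting_subdiff psi x y /\ phi x = psi x.
  move=> Ux' Vy xe xy.
  have : ((U `*` V) `&` gph (limiting_subdiff psi)) (x, y) by rewrite -gphE.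
  by move=> H; split; [case: H|exact: valE H].
have in_phi x y : U x -> V y -> limiting_subdiff psi x y ->
    limiting_subdiff phi x y.
  move=> Ux' Vy xy.
  suff [] : ((Ueps `*` V) `&` gph (limiting_subdiff phi)) (x, y) by [].
  by rewrite gphE.
split.
  have /nbhs_eball[d1 d10 Ud1] := nbhs_interior Ux.
  have /nbhs_eball[d2 d20 Vd2] := Vv.
  pose m := Num.min eps (Num.min d1 d2).
  have m0 : 0 < m by rewrite !lt_min eps0 d10.
  have [me md1 md2] : [/\ m <= eps, m <= d1 & m <= d2].
    by rewrite /m !ge_min !lexx ?orbT.
  (* Modulus 0 suffices: the subgradients of [psi] give affine minorants of [psi <= phi] on [U],
     with equality at [u]. *)
  exists m, 0; split=> // x u v.
  move=> /le_trans/(_ md1) xd1 [uv [/= /le_trans/(_ md1) ud1]].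
  move=> /le_trans/(_ md2) vd2 ue.
  have Uu := interior_subset (Ud1 _ ud1).
  have [|uv' uE] := in_psi u v Uu (Vd2 _ vd2) _ uv.
    by apply: lt_le_trans ue _; rewrite leeD2l.
  have Uxx := interior_subset (Ud1 _ xd1).
  apply: le_trans (psi_le _ Uxx).
  have := limiting_strongly_convex psiNy cvx (Ud1 _ ud1) Uxx uv'.
  apply: le_trans; rewrite uE.
  have : psi u \is a fin_num by apply: effdom_fin_num => //; case: uv'.
  case: (psi u) => // r _; rewrite -!EFinD lee_fin/=.
  have : 0 <= sigma / 2 * enorm (x - u) ^+ 2
    by rewrite mulr_ge0 ?sqr_ge0//; lra.
  lra.
(* Subdifferential continuity places every nearby graph point in [Ueps]. *)
have [d d0 phid] := phi_sc _ eps0.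
exists (interior U `&` eball xbar d), (interior V `&` eball vbar d); split.
- by apply: filterI; [exact: nbhs_interior|apply/nbhs_eball; exists d].
- by apply: filterI; [exact: nbhs_interior|apply/nbhs_eball; exists d].
move=> x y w z zw [xy [/= [Ux1 xd1] [Vy1 yd1]]].
have xfin' : phi x \is a fin_num by apply: effdom_fin_num => //; case: xy.
have [|xy' xE] := in_psi x y (interior_subset Ux1) (interior_subset Vy1) _ xy.
  have := phid x y (conj xy (conj xd1 yd1)); rewrite fin_numB_lt//.
  case: (phi x) xfin' => // a _; case: (phi xbar) xfin => // b _.
  by rewrite -EFinD lte_fin ltr_norml/=; lra.
have xpsi : psi x \is a fin_num by rewrite -xE.
have := Ux1; rewrite -[interior U x]/(nbhs x U) => Unx.
have [r r0 Ur] := (nbhs_eball _ _).1 Unx.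
have [q q0 Vq] := (nbhs_eball _ _).1 Vy1.
apply: (strong_monotone_coderivative zw) => p.
have p0 := enorm_ge0 p; have s0 := normr_ge0 (1 - sigma).
(* Sums the bounds, per unit of [t], on [|u - x|] and [|v - y|]; the final 1 makes [K] positive when
   [p = 0]. *)
pose K := 2 * enorm p + (enorm p + `|1 - sigma| * (2 * enorm p)) + 1.
have sp : 0 <= `|1 - sigma| * (2 * enorm p) by rewrite !mulr_ge0.
have K0 : 0 < K by rewrite /K; lra.
exists K, (Num.min (r / (2 * K)) (q / K)).
  by rewrite lt_min !divr_gt0// mulr_gt0.
move=> t t0; rewrite le_min !ler_pdivlMr ?mulr_gt0// => /andP[tr tq].
(* With [lambda = 1 - sigma] the minorant required is the one of curvature [sigma] that strong
   convexity provides. *)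
have [||u ux uv] := @perturbed_solution _ _ psi x y (t *: p) (1 - sigma) r lpsi
    psiNy xpsi.
- move=> u /Ur Uu; have := limiting_strongly_convex psiNy cvx Unx Uu xy'.
  by have -> : 1 - (1 - sigma) = sigma by ring.
- rewrite enormZ (gtr0_norm t0); move: tr; rewrite /K.
  have := mulr_ge0 (ltW t0) p0; have := mulr_ge0 (ltW t0) sp; lra.
have {}ux : enorm (u - x) <= 2 * enorm p * t.
  by apply: le_trans ux _; rewrite enormZ (gtr0_norm t0); lra.
set v := y + _ - _ in uv.
have vE : v - y = t *: p - (1 - sigma) *: (u - x).
  by apply/rowP => i; rewrite !mxE; ring.
have tsp := mulr_ge0 (ltW t0) sp; have tp := mulr_ge0 (ltW t0) p0.
have vy : enorm (v - y) <= (enorm p + `|1 - sigma| * (2 * enorm p)) * t.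
  rewrite vE; apply: le_trans (enormD _ _) _;
    rewrite enormN !enormZ (gtr0_norm t0).
  have : `|1 - sigma| * enorm (u - x) <= `|1 - sigma| * (2 * enorm p * t).
    by rewrite ler_wpM2l.
  lra.
have uK : enorm (u - x) <= K * t by rewrite /K; lra.
have vK : enorm (v - y) <= K * t by rewrite /K; lra.
have Uu : U u by apply: Ur; lra.
have Vv' : V v by apply: Vq; lra.
have {}uv := regular_limiting (proximal_regular psiNy uv).
exists u, v; split=> //; first exact: in_phi.
have Uu' : nbhs u U.
  apply/nbhs_eball; exists (r - r / 2) => [|u' uu']; first by lra.
  by apply: Ur; have := enorm_triangle u u' x; lra.
(* Adding the inequalities based at [x] and at [u] yields strong monotonicity. *)
have := limiting_strongly_convex psiNy cvx Unx Uu xy'.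
have := limiting_strongly_convex psiNy cvx Uu' (nbhs_singleton Unx) uv.
have ufin : psi u \is a fin_num by apply: effdom_fin_num => //; case: uv.
case: (psi u) ufin => // a _; case: (psi x) xpsi => // b _ /=.
rewrite !lee_fin (enormBC x u) => h1 h2.
have -> : dot (v - y) (u - x) = - dot v (x - u) - dot y (u - x).
  by rewrite !dotE; ring.
lra.
Qed.

Lemma cvg_flat (X_ : nat -> 'rV[R]_(n + n)) x y : X_ @ \oo --> flat (x, y) ->
  ((fun k => lsubmx (X_ k)) @ \oo --> x) /\
  ((fun k => rsubmx (X_ k)) @ \oo --> y).
Proof.
move=> /cvg_enorm XX; split; apply/cvg_enorm => e /XX; apply: filterS => k;
  apply: le_trans;
  have := enorm_le_flat (lsubmx (X_ k) - x) (rsubmx (X_ k) - y);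
  by rewrite -flatB /flat/= hsubmxK => -[].
Qed.

(** The inequality is closed in [(z, w)]; passing to interiors puts the base points of the
    approximating regular normals in [U] and [V]. *)
Lemma combined_limiting_second_order (phi : 'rV[R]_n -> \bar R) xbar vbar
    (sigma : R) :
  (exists U V : set 'rV[R]_n, [/\ nbhs xbar U, nbhs vbar V &
    forall x y w z, combined_subdiff2 phi x y w z ->
      (gph (limiting_subdiff phi) `&` (U `*` V)) (x, y) ->
      sigma * enorm w ^+ 2 <= dot z w]) ->
  exists U V : set 'rV[R]_n, [/\ nbhs xbar U, nbhs vbar V &
    forall x y w z, limiting_subdiff2 phi x y w z ->
      (gph (limiting_subdiff phi) `&` (U `*` V)) (x, y) ->
      sigma * enorm w ^+ 2 <= dot z w].
Proof.
move=> [U [V [Ux Vv H]]]; exists (interior U), (interior V).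
split; [exact: nbhs_interior|exact: nbhs_interior|].
move=> x y w z [_ [X_ [Z_ [XX _ XZ ZZ]]]] [xy [/= Ux' Vy']].
have [Xx Xy] := cvg_flat XX; have [Zz Zw] := cvg_flat ZZ.
rewrite enorm_sq -subr_ge0.
have -> : dot z w - sigma * dot w w = - dot z (- w) - sigma * dot (- w) (- w).
  by rewrite !dotE; ring.
have cv : (fun k => - dot (lsubmx (Z_ k)) (rsubmx (Z_ k)) -
     sigma * dot (rsubmx (Z_ k)) (rsubmx (Z_ k))) @ \oo -->
   - dot z (- w) - sigma * dot (- w) (- w).
  by apply: cvgB; [apply: cvgN|apply: cvgM; [exact: cvg_cst|]]; exact: cvg_dot.
apply: (cvgr_to_ge cv).
have UX : \forall k \near \oo, U (lsubmx (X_ k)) by exact: Xx.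
have VX : \forall k \near \oo, V (rsubmx (X_ k)) by exact: Xy.
near=> k.
have : regular_normal_cone (flat @` gph (limiting_subdiff phi))
    (flat (lsubmx (X_ k), rsubmx (X_ k)))
    (flat (lsubmx (Z_ k), - (- rsubmx (Z_ k)))).
  by rewrite opprK /flat/= !hsubmxK; exact: XZ.
move=> N; have := N => /regular_normal_gphP[G _].
have := H _ _ _ _ N; rewrite enormN enorm_sq dotNr => /(_ _)/wrap[|];
  last by lra.
by split=> //; split=> /=; near: k.
Unshelve. all: end_near. Qed.

End Necessity.

(** * From the second-order condition to strong monotonicity of the graph *)

Section StrongMonotonicity.
Context {R : realType} {n : nat}.
Implicit Types (x y z u v w b c : 'rV[R]_n).
Context (phi : 'rV[R]_n -> \bar R) (xbar vbar : 'rV[R]_n).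
Context (phiNy : forall z, phi z != -oo%E).
Local Notation dphi := (limiting_subdiff phi).

Definition near_graph (e : R) u v :=
  [/\ dphi u v, enorm (u - xbar) <= e & enorm (v - vbar) <= e].

Lemma near_graph_fin e u v : near_graph e u v -> phi u \is a fin_num.
Proof. by case=> -[ud _] _ _; exact: effdom_fin_num. Qed.

Definition prox_on (e r : R) := forall x u v, enorm (x - xbar) <= e ->
  near_graph e u v ->
  ((fine (phi u) + dot v (x - u) - r / 2 * enorm (x - u) ^+ 2)%:E <= phi x)%E.

Definition strongly_monotone_on (e sigma : R) := forall u1 v1 u2 v2,
  near_graph e u1 v1 -> near_graph e u2 v2 ->
  sigma * enorm (u1 - u2) ^+ 2 <= dot (v1 - v2) (u1 - u2).

Lemma near_graph_le e e' u v : e <= e' -> near_graph e u v -> near_graph e' u v.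
Proof. by move=> ee' [uv ue ve]; split=> //; exact: le_trans ee'. Qed.

(** On a small ball subdifferential continuity supplies the bound on [phi u] that prox-regularity
    asks for, so the localization involves [u] and [v] only. *)
Lemma prox_regular_prox_on : effdom phi xbar ->
  subdiff_continuous phi xbar vbar -> prox_regular phi xbar vbar ->
  exists e r, [/\ 0 < e, 0 <= r & prox_on e r].
Proof.
move=> xd phi_sc [e [r [e0 r0 pr]]].
have xfin := effdom_fin_num phiNy xd.
have [d d0 dphi'] := phi_sc _ e0.
pose m := Num.min e d; have [me md] : m <= e /\ m <= d.
  by rewrite /m !ge_min !lexx orbT.
exists m, r; split=> //; first by rewrite lt_min e0.
move=> x u v xe [uv ue ve]; have ufin : phi u \is a fin_num.
  by apply: effdom_fin_num => //; case: uv.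
have := pr x u v (le_trans xe me)
  (conj uv (conj (le_trans ue me) (le_trans ve me))).
have := dphi' u v (conj uv (conj (le_trans ue md) (le_trans ve md))).
rewrite fin_numB_lt//; case: (phi u) ufin => // a _;
  case: (phi xbar) xfin => // a' _.
by rewrite -!EFinD lte_fin ltr_norml /= => /andP[_ h]; apply; lra.
Qed.

Section Resolvent.
Context (e r : R).
Context (pr : prox_on e r).

(** Add the two prox-regularity inequalities, each point tested at the other. *)
Lemma prox_on_hypomonotone u1 v1 u2 v2 :
  near_graph e u1 v1 -> near_graph e u2 v2 ->
  - r * enorm (u1 - u2) ^+ 2 <= dot (v1 - v2) (u1 - u2).
Proof.
move=> uv1 uv2; have [[_ ue1 _] [_ ue2 _]] := (uv1, uv2).
have := pr ue2 uv1; have := pr ue1 uv2.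
move: (near_graph_fin uv1) (near_graph_fin uv2).
case: (phi u1) => // a _; case: (phi u2) => // a' _ /=.
rewrite !lee_fin (enormBC u2 u1) !dotE; lra.
Qed.

(** Adding [(r + 1) I] to an operator with defect [-r] makes it strongly monotone of modulus 1;
    Cauchy-Schwarz then makes its inverse nonexpansive. *)
Lemma resolvent_nonexpansive u1 v1 u2 v2 :
  near_graph e u1 v1 -> near_graph e u2 v2 ->
  enorm (u1 - u2) <=
    enorm (v1 + (r + 1) *: (u1 - xbar) - (v2 + (r + 1) *: (u2 - xbar))).
Proof.
move=> uv1 uv2.
have -> : v1 + (r + 1) *: (u1 - xbar) - (v2 + (r + 1) *: (u2 - xbar)) =
  v1 - v2 + (r + 1) *: (u1 - u2) by apply/rowP => i; rewrite !mxE; ring.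
have := prox_on_hypomonotone uv1 uv2.
set p := u1 - u2; set q := v1 - v2; set s := q + _ => h.
have [p0|p0] := leP (enorm p) 0; first exact: le_trans (enorm_ge0 _).
rewrite -(ler_pM2l p0) -expr2; apply: le_trans (dot_le_enorm p s).
have -> : dot p s = dot q p + (r + 1) * enorm p ^+ 2.
  by rewrite enorm_sq dotDr dotZr (dotC p q).
lra.
Qed.

Lemma resolvent_inj u1 v1 u2 v2 : near_graph e u1 v1 -> near_graph e u2 v2 ->
  v1 + (r + 1) *: (u1 - xbar) = v2 + (r + 1) *: (u2 - xbar) -> u1 = u2.
Proof.
move=> uv1 uv2 E; have := resolvent_nonexpansive uv1 uv2.
rewrite E subrr enorm0 => h; apply/eqP.
by rewrite -subr_eq0 -enorm_eq0 eq_le h enorm_ge0.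
Qed.

(** [J c] is the perturbed solution at [(xbar, vbar)] for [d = c - vbar] and [lambda = r + 1],
    prox-regularity being the required minorant. *)
Lemma local_resolvent eta : lower_semicontinuous phi -> dphi xbar vbar ->
  0 < e -> 0 <= r -> 0 < eta ->
  exists2 rho, 0 < rho & exists J : 'rV[R]_n -> 'rV[R]_n,
    forall c, enorm (c - vbar) <= rho ->
      near_graph eta (J c) (c - (r + 1) *: (J c - xbar)).
Proof.
move=> lphi xv e0 r0 eta0.
have xfin : phi xbar \is a fin_num by apply: effdom_fin_num => //; case: xv.
have K0 : 0 < 2 * (r + 1) + 2 by lra.
(* [e / 3] ensures [2 |c - vbar| < e]; the other bound absorbs [|u - xbar| <= 2 rho] and
   [|v - vbar| <= rho + 2 (r + 1) rho]. *)
pose rho := Num.min (e / 3) (eta / (2 * (r + 1) + 2)).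
have [re reta] : rho <= e / 3 /\ rho * (2 * (r + 1) + 2) <= eta.
  by rewrite -ler_pdivlMr// /rho !ge_min !lexx orbT.
have rho0 : 0 < rho by rewrite lt_min !divr_gt0.
exists rho => //.
suff H c : exists u, enorm (c - vbar) <= rho ->
    near_graph eta u (c - (r + 1) *: (u - xbar)).
  by exists (fun c => projT1 (cid (H c))) => c; exact: projT2 (cid (H c)).
(* [xbar] is a placeholder outside the ball, where nothing is claimed. *)
have [crho|/negP crho] := boolP (enorm (c - vbar) <= rho); last by exists xbar.
have [||u ux] := @perturbed_solution _ _ phi xbar vbar (c - vbar) (r + 1) e lphi
  phiNy xfin.
- move=> u ue; have xvb : near_graph e xbar vbar.
    by split=> //; rewrite subrr enorm0 ltW.
  by have := pr ue xvb; have -> : (1 - (r + 1)) / 2 = - (r / 2) by [ring];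
    rewrite mulNr.
- by lra.
rewrite [vbar + _]addrC subrK => /(proximal_regular phiNy)/regular_limiting uv.
exists u => _; split=> //.
  by apply: le_trans ux _; have := mulr_ge0 r0 (ltW rho0); lra.
rewrite addrAC; apply: le_trans (enormD _ _) _.
rewrite enormN enormZ ger0_norm; last by lra.
have : (r + 1) * enorm (u - xbar) <= (r + 1) * (2 * rho).
  by rewrite ler_wpM2l//; lra.
have := mulr_ge0 r0 (ltW rho0); lra.
Qed.

End Resolvent.

(** Under [c = v + (r + 1) (u - xbar)] nearby graph points are exactly the pairs with [u = J c], so
    the proximal inequality for [<b, J .>] becomes one for the graph, with normal
    [((r + 1) w - b, w)]. *)
Lemma proximal_graph_normal e r J (rho : R) b c w :
  0 < e -> 0 <= r -> prox_on e r ->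
  (forall c, enorm (c - vbar) <= rho ->
      near_graph (e / 2) (J c) (c - (r + 1) *: (J c - xbar))) ->
  enorm (c - vbar) < rho ->
  proximal_subdiff (fun c => (dot b (J c))%:E) c w ->
  combined_subdiff2 phi (J c) (c - (r + 1) *: (J c - xbar)) (- w)
    ((r + 1) *: w - b).
Proof.
move=> e0 r0 pr HJ crho [_ [C [d d0 Hd]]].
have Jc := HJ _ (ltW crho); have Jce := near_graph_le (_ : e / 2 <= e) Jc.
rewrite /combined_subdiff2/= opprK; apply/regular_normal_gphP.
split=> [|eps eps0]; first by case: Jc.
set x := J c in Jc Jce *; set mu := r + 1; set y := c - _ *: _ in Jc Jce *.
have C1 : 0 < 2 * (`|C| + 1) * (1 + mu) ^+ 2.
  by rewrite !mulr_gt0 ?exprn_gt0 ?ltr_wpDl//; rewrite /mu; lra.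
have mu1 : 0 < 2 * (1 + mu) by rewrite /mu; lra.
(* Since [|c' - c| <= 2 (1 + mu) m], the bounds keep, in order: [(u, v)] in the region of [pr], [c']
   where the proximal inequality holds, [c'] in the domain of [J], and the quadratic error below
   [eps]. *)
pose m := Num.min (Num.min (e / 2) (d / (2 * (1 + mu))))
  (Num.min ((rho - enorm (c - vbar)) / (2 * (1 + mu)))
           (eps / (2 * (`|C| + 1) * (1 + mu) ^+ 2))).
have [me md mr meps] : [/\ m <= e / 2, m * (2 * (1 + mu)) <= d,
    m * (2 * (1 + mu)) <= rho - enorm (c - vbar) &
    m * (2 * (`|C| + 1) * (1 + mu) ^+ 2) <= eps].
  by rewrite -!ler_pdivlMr// /m !ge_min !lexx !orbT.
have m0 : 0 < m by rewrite !lt_min !divr_gt0// subr_gt0.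
exists m => // u v uv um vm.
have uve : near_graph e u v.
  case: Jc => _ h1 h2; split=> //.
    by have := enorm_triangle x u xbar; lra.
  by have := enorm_triangle y v vbar; lra.
pose c' := v + mu *: (u - xbar).
have cc : c' - c = (v - y) + mu *: (u - x).
  by rewrite /c' /y /mu; apply/rowP => i; rewrite !mxE; ring.
have mu0 : 0 <= mu by rewrite /mu; lra.
have ccS : enorm (c' - c) <= (1 + mu) * (enorm (u - x) + enorm (v - y)).
  rewrite cc; apply: le_trans (enormD _ _) _; rewrite enormZ ger0_norm//.
  have := mulr_ge0 mu0 (enorm_ge0 (v - y)); have := enorm_ge0 (u - x); lra.
have ccm : enorm (c' - c) <= m * (2 * (1 + mu)).
  apply: le_trans ccS _; rewrite mulrC mulrA ler_wpM2r//; lra.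
have c'rho : enorm (c' - vbar) <= rho.
  by have := enorm_triangle c c' vbar; lra.
(* [u] and [J c'] solve the same resolvent equation, which is injective. *)
have Ju : J c' = u.
  have Jc'e : near_graph e (J c') (c' - (r + 1) *: (J c' - xbar)).
    by apply: near_graph_le (HJ _ c'rho); lra.
  by apply: (resolvent_inj pr Jc'e uve); rewrite subrK.
have := Hd _ (le_trans ccm md); rewrite Ju lee_fin/= -/x.
have -> : dot ((r + 1) *: w - b) (u - x) + dot w (v - y) =
    dot w (c' - c) - dot b u + dot b x.
  rewrite cc (dotDr (v - y)) dotZr dotDl dotNl dotZl [dot b (u - x)]dotDr dotNr.
  by rewrite -/mu; ring.
move=> h; have : C * enorm (c' - c) ^+ 2 <=
    eps * (enorm (u - x) + enorm (v - y)).
  set S := enorm (u - x) + _ in ccS *; set D := enorm (c' - c) in ccS ccm *.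
  have D0 : 0 <= D := enorm_ge0 _.
  have S0 : 0 <= S by rewrite addr_ge0 ?enorm_ge0.
  apply: (@le_trans _ _ ((`|C| + 1) * D ^+ 2)).
    by rewrite ler_wpM2r ?sqr_ge0//; have := ler_norm C; lra.
  apply: (@le_trans _ _ ((`|C| + 1) * (m * (2 * (1 + mu)) * ((1 + mu) * S)))).
    by rewrite ler_wpM2l ?addr_ge0// expr2 ler_pM.
  apply: (@le_trans _ _ (m * (2 * (`|C| + 1) * (1 + mu) ^+ 2) * S)).
    by rewrite le_eqVlt; apply/orP; left; apply/eqP; ring.
  by rewrite ler_wpM2r.
lra.
Qed.

Lemma second_order_strongly_monotone (sigma e r : R) :
  lower_semicontinuous phi -> dphi xbar vbar -> 0 < sigma ->
  0 < e -> 0 <= r -> prox_on e r ->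
  (exists U V : set 'rV[R]_n, [/\ nbhs xbar U, nbhs vbar V &
    forall x y w z, combined_subdiff2 phi x y w z ->
      (gph dphi `&` (U `*` V)) (x, y) -> sigma * enorm w ^+ 2 <= dot z w]) ->
  exists2 rho, 0 < rho & strongly_monotone_on rho sigma.
Proof.
move=> lphi xv sigma0 e0 r0 pr [U [V [/nbhs_eball[d1 d10 Ud1]
  /nbhs_eball[d2 d20 Vd2] H]]].
pose eta := Num.min (e / 2) (Num.min d1 d2).
have eta0 : 0 < eta by rewrite !lt_min divr_gt0// d10.
have [etae eta1 eta2] : [/\ eta <= e / 2, eta <= d1 & eta <= d2].
  by rewrite /eta !ge_min !lexx ?orbT.
have [rho rho0 [J HJ]] := local_resolvent pr lphi xv e0 r0 eta0.
have HJ2 c (crho : enorm (c - vbar) <= rho) := near_graph_le etae (HJ c crho).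
have ee : e / 2 <= e by lra.
have HJe c (crho : enorm (c - vbar) <= rho) := near_graph_le ee (HJ2 c crho).
pose kappa := r + 1 + sigma.
have kappa0 : 0 < kappa by rewrite /kappa; lra.
have Jlip c c' : enorm (c - vbar) <= rho -> enorm (c' - vbar) <= rho ->
    enorm (J c - J c') <= enorm (c - c').
  move=> /HJe h /HJe h'; apply: le_trans (resolvent_nonexpansive pr h h') _.
  by rewrite !subrK.
(* The hypothesis at the normal just found, in direction [- w], reads
   [sigma |w|^2 <= <b, w> - (r + 1) |w|^2]. *)
have scal b c w : enorm (c - vbar) < rho ->
    proximal_subdiff (fun c => (dot b (J c))%:E) c w ->
    kappa * enorm w ^+ 2 <= dot b w.
  move=> crho /(proximal_graph_normal e0 r0 pr HJ2 crho) N.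
  have [Jc1 Jc2 Jc3] := HJ _ (ltW crho).
  have := H _ _ _ _ N; rewrite enormN => /(_ _)/wrap[|].
    split=> //; split=> /=; first by apply: Ud1; exact: le_trans eta1.
    by apply: Vd2; exact: le_trans eta2.
  rewrite /kappa !dotE -enorm_sq; lra.
have coco c c' : enorm (c - vbar) <= rho / 5 -> enorm (c' - vbar) <= rho / 5 ->
    kappa * enorm (J c - J c') ^+ 2 <= dot (c - c') (J c - J c').
  move=> cr cr'; pose b := 2 * kappa *: (J c - J c') - (c - c').
  pose g c := 2 * kappa * dot b (J c) - dot b c.
  have rho5 : 5 * (rho / 5) = rho by field.
  have b0 := enorm_ge0 b.
  (* For this [b] the left side is [|b|^2], so [|b| <= |c - c'|]; with [p = J c - J c'] and
     [q = c - c'], the bound [|2 kappa p - q| <= |q|] is [kappa |p|^2 <= <q, p>]. *)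
  suff : g c - g c' <= enorm b * enorm (c - c').
    have -> : g c - g c' = enorm b ^+ 2.
      rewrite enorm_sq -[RHS]/(dot b (2 * kappa *: (J c - J c') - (c - c'))) /g.
      by rewrite dotDr dotNr dotZr (dotDr (J c)) (dotDr c) !dotNr; ring.
    move=> bc; have : enorm b <= enorm (c - c').
      have [bn|bp] := leP (enorm b) 0; first exact: le_trans (enorm_ge0 _).
      by rewrite -(ler_pM2l bp) -expr2.
    rewrite enorm_le ?enorm_ge0// enorm_sq /b.
    move: (J c - J c') (c - c') => p q; rewrite enorm_sq !dotE (dotC p q) => h.
    by rewrite -(ler_pM2l (_ : 0 < 4 * kappa)); lra.
  clearbody b.
  apply: (@proximal_lipschitz _ _ g vbar (rho / 5) ((2 * kappa + 1) * enorm b)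
    (enorm b)) => //; rewrite ?rho5.
  - by rewrite mulr_ge0//; lra.
  - move=> c1 c2 /Jlip/[apply] J12.
    have -> : g c1 - g c2 = 2 * kappa * dot b (J c1 - J c2) + dot b (c2 - c1).
      by rewrite /g !dotDr !dotNr; ring.
    have h1 : 2 * kappa * dot b (J c1 - J c2) <=
        2 * kappa * (enorm b * enorm (c1 - c2)).
      rewrite ler_wpM2l//; first by lra.
      by apply: le_trans (dot_le_enorm _ _) _; rewrite ler_wpM2l.
    have := dot_le_enorm b (c2 - c1); rewrite (enormBC c2 c1); lra.
  - move=> c1 om c1r [_ [C [d d0 Hd]]].
    (* [(om + b) / (2 kappa)] is a proximal subgradient of [<b, J .>]; [scal] becomes
       [|om + b|^2 <= 2 <b, om + b>], that is, [|om| <= |b|]. *)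
    have := scal b c1 ((2 * kappa)^-1 *: (om + b)) c1r => /(_ _)/wrap[|].
      split=> //; exists (C / (2 * kappa)), d => // c2 /Hd.
      rewrite !lee_fin/= /g dotZl dotDl [dot b (c2 - c1)]dotDr dotNr => h.
      rewrite -(ler_pM2l (_ : 0 < 2 * kappa)); last by lra.
      have -> : 2 * kappa * (dot b (J c1) + (2 * kappa)^-1 *
        (dot om (c2 - c1) + (dot b c2 - dot b c1)) -
        C / (2 * kappa) * enorm (c2 - c1) ^+ 2) =
        2 * kappa * dot b (J c1) + (dot om (c2 - c1) + (dot b c2 - dot b c1)) -
        C * enorm (c2 - c1) ^+ 2 by field; rewrite gt_eqF.
      lra.
    rewrite enorm_le// -enorm_sq enormZ ger0_norm;
      last by rewrite invr_ge0; lra.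
    rewrite dotZr exprMn !enorm_sq !dotE (dotC b om) => h.
    have : 4 * kappa * (kappa * ((2 * kappa)^-1 ^+ 2 * (dot om om + dot om b +
      (dot om b + dot b b)))) <=
      4 * kappa * ((2 * kappa)^-1 * (dot om b + dot b b)).
      by rewrite ler_pM2l//; lra.
    have -> : 4 * kappa * (kappa * ((2 * kappa)^-1 ^+ 2 * (dot om om +
      dot om b + (dot om b + dot b b)))) = dot om om + dot om b + (dot om b + dot b b).
      by field; rewrite gt_eqF.
    have -> : 4 * kappa * ((2 * kappa)^-1 * (dot om b + dot b b)) =
      2 * (dot om b + dot b b) by field; rewrite gt_eqF.
    lra.
(* A graph point within [m] has [|c - vbar| <= m + (r + 1) m], which must stay within [rho / 5]. *)
pose m := Num.min e (rho / 5 / (r + 2)).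
have r2 : 0 < r + 2 by lra.
have [me mr] : m <= e /\ m * (r + 2) <= rho / 5.
  by rewrite -ler_pdivlMr// /m !ge_min !lexx orbT.
have m0 : 0 < m by rewrite lt_min e0 !divr_gt0.
have Jinv u v : near_graph m u v ->
    enorm (v + (r + 1) *: (u - xbar) - vbar) <= rho / 5 /\
    J (v + (r + 1) *: (u - xbar)) = u.
  move=> uvm; have [uv um vm] := uvm; set c := v + _.
  have cr : enorm (c - vbar) <= rho / 5.
    rewrite /c addrAC; apply: le_trans (enormD _ _) _.
    rewrite enormZ ger0_norm; last by lra.
    have : (r + 1) * enorm (u - xbar) <= (r + 1) * m
      by rewrite ler_wpM2l//; lra.
    lra.
  split=> //; have crho : enorm (c - vbar) <= rho by lra.
  by apply: (resolvent_inj pr (HJe _ crho) (near_graph_le me uvm));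
    rewrite subrK.
exists m => // u1 v1 u2 v2 /Jinv[c1 J1] /Jinv[c2 J2].
have := coco _ _ c1 c2; rewrite J1 J2.
have -> : v1 + (r + 1) *: (u1 - xbar) - (v2 + (r + 1) *: (u2 - xbar)) =
  (v1 - v2) + (r + 1) *: (u1 - u2) by apply/rowP => i; rewrite !mxE; ring.
(* The [r + 1] in [kappa] cancels the shift of the resolvent, leaving [sigma]. *)
rewrite /kappa [dot (_ + _) _]dotDl dotZl -enorm_sq; lra.
Qed.

End StrongMonotonicity.

(** * Quadratic minorants and their envelope *)

Section Sufficiency.
Context {R : realType} {n : nat}.
Implicit Types (x y z u v w c : 'rV[R]_n).
Context (phi : 'rV[R]_n -> \bar R) (xbar vbar : 'rV[R]_n).
Context (phiNy : forall z, phi z != -oo%E).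
Local Notation near_graph := (near_graph phi xbar vbar).

Definition minorant (sigma : R) u v x : R :=
  fine (phi u) + dot v (x - u) + sigma / 2 * enorm (x - u) ^+ 2.

(* If [phi x] lies below the quadratic minorant of modulus [sigma] at [(u, v)],
   it lies below the one of some modulus [sigma' < sigma], and [descent_point]
   applied to the difference gives a pair of the graph that violates strong
   monotonicity against [(u, v)]. *)
Lemma strongly_monotone_minorant (sigma e r rho : R) :
  lower_semicontinuous phi -> 0 < sigma -> 0 < e -> 0 <= r -> 0 < rho ->
  prox_on phi xbar vbar e r -> strongly_monotone_on phi xbar vbar rho sigma ->
  exists2 rho', 0 < rho' & forall x u v, enorm (x - xbar) <= rho' ->
    near_graph rho' u v -> ((minorant sigma u v x)%:E <= phi x)%E.
Proof.
move=> lphi sigma0 e0 r0 rho0 pr mono.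
(* Points within [2 s <= 4 rho'] of [u] are within [5 rho'] of [xbar]; the rest absorbs
   [|sg - m| |y - u|], with [m <= 4 (r + sigma)] and [|y - u| < 4 rho']. *)
pose K := 5 + 4 * (sigma + 4 * (r + sigma)).
have K0 : 0 < K by rewrite /K; lra.
pose rho' := Num.min e rho / K.
have rho'0 : 0 < rho' by rewrite divr_gt0// lt_min e0.
have [Ke Krho] : rho' * K <= e /\ rho' * K <= rho.
  by rewrite /rho' divfK ?gt_eqF// !ge_min !lexx orbT.
have h5 : rho' * 5 <= rho' * K by rewrite ler_pM2l// /K; lra.
exists rho' => // x u v xr uv; have [uv1 ur vr] := uv.
rewrite leNgt; apply/negP => xq.
have ufin := near_graph_fin phiNy uv.
have [t tE] : exists t, phi x = t%:E.
  by case: (phi x) xq (phiNy x) => [t _ _|//|//]; exists t.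
move: xq; rewrite tE lte_fin /minorant => xq.
set s := enorm (x - u) in xq.
have s0 : 0 < s.
  rewrite /s enorm_gt0 subr_eq0; apply: contraTN xq => /eqP xu.
  have -> : t = fine (phi u) by rewrite -xu tE.
  by rewrite /s xu subrr dot0r enorm0 expr0n mulr0 !addr0 ltxx.
have s20 : 0 < s ^+ 2 by rewrite exprn_gt0.
have s2 : s <= 2 * rho'.
  by have := enorm_triangle xbar x u; rewrite -/s (enormBC xbar u); lra.
pose D := fine (phi u) + dot v (x - u) + sigma / 2 * s ^+ 2 - t.
have D0 : 0 < D by rewrite /D subr_gt0.
(* Lowering the modulus by at most [D / s^2] lowers the minorant at [x] by at most [D / 2], so it
   still exceeds [phi x]. *)
pose sg := sigma - Num.min sigma (D / s ^+ 2).
have [sg0 sgs sgx] : [/\ 0 <= sg, sg < sigma &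
    t < fine (phi u) + dot v (x - u) + sg / 2 * s ^+ 2].
  have : Num.min sigma (D / s ^+ 2) <= D / s ^+ 2 by rewrite ge_min lexx orbT.
  rewrite ler_pdivlMr// => hD.
  split; first by rewrite /sg subr_ge0 ge_min lexx.
    by rewrite /sg ltrBlDr ltrDl lt_min sigma0 divr_gt0.
  by rewrite /sg; rewrite /D in D0 hD; lra.
pose k y := - dot v (y - u) - sg / 2 * enorm (y - u) ^+ 2.
have ck : continuous k.
  move=> y; exact: (cvgB (cvgN (@dotB_continuous _ _ v u y))
    (cvgM (cvg_cst (sg / 2)) (@enormB_sq_continuous _ _ u y))).
pose F y := (phi y + (k y)%:E)%E.
have Fu : F u = phi u.
  by rewrite /F /k subrr dot0r enorm0 expr0n mulr0 !subr0 oppr0 adde0.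
have Bxbar y : eball u (2 * s) y -> enorm (y - xbar) <= rho' * 5.
  by rewrite /eball/=; have := enorm_triangle u y xbar; lra.
(* Prox-regularity gives the lower bound: [(r + sg) / 2 * |y - u|^2] is at most this [B] when
   [|y - u| <= 2 s]. *)
have [||||||y [m [y0 ys m0 mB yF]]] := @descent_point _ _ F u x
  (2 * (r + sigma) * s ^+ 2).
- by apply: lsc_onD ck; exact: lower_semicontinuous_lsc_on.
- by move=> z; rewrite /F; case: (phi z) (phiNy z).
- by rewrite mulr_ge0 ?sqr_ge0//; lra.
- by rewrite Fu.
- rewrite Fu /F tE -(fineK ufin) -EFinD lte_fin /k -/s; lra.
- move=> y yu; have := Bxbar _ yu => yx; rewrite Fu /F.
  have uve : near_graph e u v by apply: near_graph_le uv; lra.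
  have yxe : enorm (y - xbar) <= e by lra.
  have := pr _ _ _ yxe uve.
  case: (phi y) (phiNy y) => // [a _|_ _]; last by rewrite leey.
  rewrite -EFinD !lee_fin /k => ha.
  have : (r + sg) / 2 * enorm (y - u) ^+ 2 <= (r + sigma) / 2 * (2 * s) ^+ 2.
    apply: ler_pM; [lra|exact: sqr_ge0|lra|].
    by rewrite ler_pXn2r// nnegrE ?enorm_ge0//; lra.
  lra.
have yfin : phi y \is a fin_num.
  by case: yF => + _; rewrite /F; case: (phi y) (phiNy y).
pose vy := v + (sg - m) *: (y - u).
have yvy : limiting_subdiff phi y vy.
  apply: regular_limiting; apply: proximal_regular => //; split=> //.
  case: yF => _ [C [d d0 Hd]]; exists (C - sg / 2), d => // z /Hd.
  rewrite /F; case: (phi y) yfin => // a _.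
  case: (phi z) (phiNy z) => // [b _|_ _]; last by rewrite leey.
  rewrite -!EFinD !lee_fin/= /k /vy !enorm_sq !dotE.
  by rewrite (dotC z y) (dotC z u) (dotC y u); lra.
rewrite -/s in mB ys; have m4 : m <= 4 * (r + sigma)
  by rewrite -(ler_pM2r s20); lra.
have yvyr : near_graph rho y vy.
  split=> //; first by have := Bxbar _ (ltW ys); lra.
  rewrite /vy addrAC; apply: le_trans (enormD _ _) _; rewrite enormZ.
  have : `|sg - m| * enorm (y - u) <= (sigma + 4 * (r + sigma)) * (4 * rho').
    apply: ler_pM; [by []|exact: enorm_ge0| |lra].
    by rewrite ler_norml; lra.
  move: Krho; rewrite /K; lra.
have uvr : near_graph rho u v by apply: near_graph_le uv; lra.
(* Strong monotonicity would force [sigma <= sg - m], but [sg < sigma] and [m >= 0]. *)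
have := mono _ _ _ _ yvyr uvr.
have -> : vy - v = (sg - m) *: (y - u) by rewrite /vy addrAC subrr add0r.
rewrite dotZl -enorm_sq ler_pM2r ?exprn_gt0//; lra.
Qed.

Lemma eball_convex (a : 'rV[R]_n) (d : R) :
  convex_set (eball a d : set (convex_lmodType 'rV[R]_n)).
Proof.
move=> x y l /set_mem xd /set_mem yd; apply/mem_set.
have [l0 l1] : 0 <= l%:num /\ l%:num <= 1 by split.
rewrite /eball/=.
have -> : (conv l x y : 'rV[R]_n) - a =
    l%:num *: (x - a) + (1 - l%:num) *: (y - a).
  rewrite -[conv l x y]/(l%:num *: (x : 'rV[R]_n) +
    (1 - l%:num) *: (y : 'rV[R]_n)).
  by apply/rowP => i; rewrite !mxE; ring.
apply: le_trans (enormD _ _) _; rewrite !enormZ !ger0_norm ?subr_ge0//.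
rewrite /eball/= in xd yd; have := ler_wpM2l l0 xd.
have := ler_wpM2l (_ : 0 <= 1 - l%:num) yd; rewrite subr_ge0 => /(_ l1); lra.
Qed.

Definition envelope (sigma rho : R) x : \bar R :=
  ereal_sup [set (minorant sigma p.1 p.2 x)%:E | p in
    [set p | near_graph rho p.1 p.2]].

Lemma minorant_le_envelope (sigma rho : R) u v x : near_graph rho u v ->
  ((minorant sigma u v x)%:E <= envelope sigma rho x)%E.
Proof. by move=> uv; apply: ereal_sup_ubound; exists (u, v). Qed.

Lemma minorant_base (sigma : R) u v : minorant sigma u v u = fine (phi u).
Proof. by rewrite /minorant subrr dot0r enorm0 expr0n mulr0 !addr0. Qed.

Lemma envelope_lsc (sigma rho : R) : lower_semicontinuous (envelope sigma rho).
Proof.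
move=> x a /ereal_sup_gt[_ [[u v] /= uv <-]]; rewrite lte_fin => ax.
have cm : continuous (minorant sigma u v).
  move=> y; exact: (cvgD (cvgD (cvg_cst (fine (phi u)))
    (@dotB_continuous _ _ v u y))
    (cvgM (cvg_cst (sigma / 2)) (@enormB_sq_continuous _ _ u y))).
exists [set y | a < minorant sigma u v y]; first exact: (cm x _ (lt_nbhsr ax)).
by move=> y /= ay; apply: lt_le_trans (minorant_le_envelope _ _ uv);
  rewrite lte_fin.
Qed.

(** Each minorant minus [sigma/2 |.|^2] is affine, and a supremum of affine functions is convex. *)
Lemma envelope_strongly_convex (sigma rho : R) (U : set 'rV[R]_n) :
  strongly_convex_on U sigma (envelope sigma rho).
Proof.
move=> x y t _ _ /andP[t0 t1].
rewrite leeBlDr//; apply: ge_ereal_sup => _ [[u v] /= uv <-];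
  rewrite -leeBlDr//.
have t1' : 0 <= 1 - t by rewrite subr_ge0.
have H z : ((minorant sigma u v z - sigma / 2 * enorm z ^+ 2)%:E <=
    envelope sigma rho z - (sigma / 2 * enorm z ^+ 2)%:E)%E.
  by rewrite EFinB leeD2r//; exact: minorant_le_envelope.
apply: (@le_trans _ _ (t%:E *
    (minorant sigma u v x - sigma / 2 * enorm x ^+ 2)%:E +
    (1 - t)%:E * (minorant sigma u v y - sigma / 2 * enorm y ^+ 2)%:E)%E).
  rewrite -EFinB -!EFinM -EFinD lee_fin /minorant !enorm_sq !dotE.
  by rewrite (dotC x y) (dotC u x) (dotC u y); lra.
by rewrite leeD// lee_wpmul2l.
Qed.

End Sufficiency.

(** The witnesses are balls of radius [a], the envelope of the minorants at graph points within [m],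
    and [eps = 1]. *)
Lemma second_order_variationally_strongly_convex (R : realType) (n : nat)
    (phi : 'rV[R]_n -> \bar R) (xbar vbar : 'rV[R]_n) (sigma : R) :
  (forall z, phi z != -oo%E) -> lower_semicontinuous phi -> effdom phi xbar ->
  limiting_subdiff phi xbar vbar -> subdiff_continuous phi xbar vbar ->
  0 < sigma -> prox_regular phi xbar vbar ->
  (exists U V : set 'rV[R]_n, [/\ nbhs xbar U, nbhs vbar V &
    forall x y w z, combined_subdiff2 phi x y w z ->
      (gph (limiting_subdiff phi) `&` (U `*` V)) (x, y) ->
      sigma * enorm w ^+ 2 <= dot z w]) ->
  variationally_strongly_convex phi xbar vbar sigma.
Proof.
move=> phiNy lphi xd xv phi_sc sigma0 phi_pr second_order.
have xfin := effdom_fin_num phiNy xd.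
have [e [r [e0 r0 pr]]] := prox_regular_prox_on phiNy xd phi_sc phi_pr.
have [rho rho0 mono] :=
  second_order_strongly_monotone phiNy lphi xv sigma0 e0 r0 pr second_order.
have [rho' rho'0 minor] :=
  strongly_monotone_minorant phiNy lphi sigma0 e0 r0 rho0 pr mono.
have [d d0 phid] := phi_sc _ (@ltr01 R).
pose m := Num.min rho' d.
have m0 : 0 < m by rewrite lt_min rho'0.
have [mr md] : m <= rho' /\ m <= d by rewrite /m !ge_min !lexx orbT.
have [q q0 [J HJ]] := local_resolvent phiNy pr lphi xv e0 r0 m0.
have r2 : 0 < r + 2 by lra.
pose a := Num.min m (q / (r + 2)).
have a0 : 0 < a by rewrite lt_min m0 divr_gt0.
have [am aq] : a <= m /\ a * (r + 2) <= q.
  by rewrite -ler_pdivlMr// /a; split; rewrite ge_min lexx ?orbT.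
pose psi := envelope phi xbar vbar sigma m.
have psiNy z : psi z != -oo%E.
  rewrite -ltNye; apply: lt_le_trans
    (minorant_le_envelope sigma (u := xbar) (v := vbar) z _).
    by rewrite ltNyr.
  by split=> //; rewrite subrr enorm0 ltW.
have psi_le x : enorm (x - xbar) <= m -> (psi x <= phi x)%E.
  move=> xm; apply: ge_ereal_sup => _ [[u v] /= uv <-].
  by apply: minor (near_graph_le mr uv); exact: le_trans mr.
have psiE x v : near_graph phi xbar vbar m x v -> psi x = phi x.
  move=> xvm; have [_ xm _] := xvm; apply/eqP; rewrite eq_le psi_le//=.
  rewrite -(fineK (near_graph_fin phiNy xvm)) -(minorant_base phi sigma x v).
  exact: minorant_le_envelope.
have psi_cvx U : strongly_convex_on U sigma psi
  by exact: envelope_strongly_convex.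
(* A Minty-type maximality argument: the resolvent gives a graph point [(u, w)] of [phi] with
   [w + (r + 1) u = v + (r + 1) x], and [(u, w)] is shown to equal [(x, v)]. *)
have psi_graph x v : enorm (x - xbar) <= a -> enorm (v - vbar) <= a ->
    limiting_subdiff psi x v -> near_graph phi xbar vbar m x v.
  move=> xa va xvpsi; pose c := v + (r + 1) *: (x - xbar).
  have cq : enorm (c - vbar) <= q.
    rewrite /c addrAC; apply: le_trans (enormD _ _) _.
    rewrite enormZ ger0_norm; last by lra.
    have : (r + 1) * enorm (x - xbar) <= (r + 1) * a
      by rewrite ler_wpM2l//; lra.
    lra.
  have := HJ _ cq; set u := J c; set w := c - _ => uw.
  have ufin := near_graph_fin phiNy uw.
  have := minorant_le_envelope sigma x uw; rewrite -/psi /minorant.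
  have xT : nbhs x [set: 'rV[R]_n] by exact: filterT.
  have := limiting_strongly_convex psiNy (psi_cvx setT) xT (I : setT u) xvpsi.
  have : psi x \is a fin_num by apply: effdom_fin_num => //; case: xvpsi.
  rewrite (psiE _ _ uw).
  case: (psi x) => // s _; case: (phi u) ufin => // t _;
    rewrite !lee_fin/= => h1 h2.
  have wv : w = v + (r + 1) *: (x - u).
    by rewrite /w /c; apply/rowP => i; rewrite !mxE; ring.
  (* The sum of [h1] and [h2] is [(r + 1 + sigma) |x - u|^2 <= 0]. *)
  have ux : x = u.
    apply/eqP; rewrite -subr_eq0 -enorm_eq0 -sqrf_eq0 eq_le sqr_ge0 andbT.
    rewrite -(ler_pM2l (_ : 0 < r + 1 + sigma)); last by lra.
    move: h2; rewrite wv dotDl dotZl -enorm_sq.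
    have -> : dot v (x - u) = - dot v (u - x) by rewrite -dotNr opprB.
    rewrite (enormBC u x) in h1; lra.
  by have := uw; rewrite wv -ux subrr scaler0 addr0.
(* The minorant at [(x, v)] lies below [psi] and touches it at [x], so [v] is a proximal subgradient
   with constant [- (sigma / 2)]. *)
have graph_psi x v : near_graph phi xbar vbar m x v -> limiting_subdiff psi x v.
  move=> xvm; apply: regular_limiting; apply: proximal_regular => //.
  split; first by rewrite (psiE _ _ xvm) (near_graph_fin phiNy xvm).
  exists (- (sigma / 2)), 1 => // y _; rewrite (psiE _ _ xvm) mulNr opprK.
  exact: (minorant_le_envelope sigma y xvm).
have near_phi x v : near_graph phi xbar vbar m x v ->
    (phi x < phi xbar + 1%:E)%E.
  move=> xvm; have xfin' := near_graph_fin phiNy xvm; have [xv' xm vm] := xvm.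
  have := phid x v (conj xv' (conj (le_trans xm md) (le_trans vm md))).
  rewrite fin_numB_lt//; case: (phi x) xfin' => // s _.
  by case: (phi xbar) xfin => // t _; rewrite lte_fin ltr_norml/=; lra.
exists (eball xbar a), (eball vbar a); split.
- by apply/nbhs_eball; exists a.
- by apply/nbhs_eball; exists a.
- exact: eball_convex.
- exact: eball_convex.
exists psi, 1; split=> //.
- split; last exact: envelope_lsc.
  split=> //; exists xbar; rewrite /effdom/= (le_lt_trans (psi_le _ _))//.
  by rewrite subrr enorm0 ltW.
- by split=> // x xa; apply: psi_le; exact: le_trans am.
- apply/seteqP; split=> -[x v] [[/= xa va] xv'].
    case: xa => xa _; split=> //; apply: graph_psi.
    by split=> //; [exact: le_trans am|exact: le_trans am].
  have xvm := psi_graph _ _ xa va xv'.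
  by split; [split=> //; split=> //; exact: near_phi xvm|case: xvm].
- move=> x v [[/= xa va] xv']; apply/esym.
  exact: psiE (psi_graph _ _ xa va xv').
Qed.

Theorem theorem5p4 (R : realType) (n : nat) (phi : 'rV[R]_n -> \bar R)
    (xbar vbar : 'rV[R]_n) (sigma : R)
    (phi_proper : proper_fun phi)
    (phi_lsc : lower_semicontinuous phi)
    (xbar_dom : effdom phi xbar)
    (vbar_sub : limiting_subdiff phi xbar vbar)
    (phi_sc : subdiff_continuous phi xbar vbar)
    (sigma_gt0 : 0 < sigma) :
  [<-> (* i *)
       variationally_strongly_convex phi xbar vbar sigma;
       (* ii *)
       prox_regular phi xbar vbar /\
       (exists U V : set 'rV[R]_n, [/\ nbhs xbar U, nbhs vbar V &
          forall x y w z : 'rV[R]_n,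
            combined_subdiff2 phi x y w z ->
            (gph (limiting_subdiff phi) `&` (U `*` V)) (x, y) ->
            sigma * enorm w ^+ 2 <= dot z w]);
       (* iii *)
       prox_regular phi xbar vbar /\
       (exists U V : set 'rV[R]_n, [/\ nbhs xbar U, nbhs vbar V &
          forall x y w z : 'rV[R]_n,
            limiting_subdiff2 phi x y w z ->
            (gph (limiting_subdiff phi) `&` (U `*` V)) (x, y) ->
            sigma * enorm w ^+ 2 <= dot z w])].
Proof.
have [phiNy _] := phi_proper; tfae.
- by move=> vsc; exact: variationally_strongly_convex_second_order vsc
    sigma_gt0.
- by move=> [pr so]; split=> //; exact: combined_limiting_second_order.
- move=> [pr [U [V [Ux Vv so]]]].
  apply: second_order_variationally_strongly_convex => //.
  (* Regular normals are limiting normals, so (iii) contains the inequality of (ii). *)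
  by exists U, V; split=> // x y w z /regular_limiting; exact: so.
Qed.
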